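(* Let $n, s \in \mathbb{N}$ and let $g_1, \dots, g_s \in \mathbb{R}[\bar X] = \mathbb{R}[X_1, \dots, X_n]$ be such that $$\emptyset \ne S = \{\bar x \in \mathbb{R}^{n} \mid g_1(\bar x) \ge 0, \dots, g_s(\bar x) \ge 0\} \subset (-1,1)^n$$ and such that the quadratic module $M(g_1, \dots, g_s)$ generated by $g_1, \dots, g_s$ in $\mathbb{R}[\bar X]$ is archimedean. Then there exists a positive constant $c$ (depending on $g_1, \dots, g_s$ but not on $f$) such that for every $f \in \mathbb{R}[\bar X, Y]$ positive on $S \times \mathbb{R}$, if $\deg_{\bar X} f = d$, $\deg_Y f = m$, $f$ is fully $m$-ic on $S$ and $$f^{\bullet} = \min\{\bar f(\bar x, y, z) \mid \bar x \in S,\ (y,z) \in C\} > 0,$$ then $f$ can be written as $$f = \sigma_0 + \sigma_1 g_1 + \dots + \sigma_s g_s \in M_{\mathbb{R}[\bar X, Y]}(g_1, \dots, g_s)$$ with $\sigma_0, \sigma_1, \dots, \sigma_s \in \sum \mathbb{R}[\bar X, Y]^2$ and $$\deg(\sigma_0), \deg(\sigma_1 g_1), \dots, \deg(\sigma_s g_s) \le c\,(m+1)\,2^{\frac{m}{2}}\, \mathrm{e}^{\left( \frac{\|f\|_{\bullet}(m+1)d^2(3n)^d}{f^{\bullet}} \right)^{c}}.$$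
   Context: $\bar X = (X_1,\dots,X_n)$; $\mathrm{e}$ is the base of the natural logarithm; $\sum A^2$ denotes the set of finite sums of squares of elements of a ring $A$; $\deg$ is total degree, and $\deg_{\bar X}$, $\deg_Y$ are the degrees in the variables $\bar X$ (total) and $Y$ respectively. The quadratic module generated by $g_1,\dots,g_s$ in $\mathbb{R}[\bar X]$ is $M(g_1,\dots,g_s) = \{\sigma_0 + \sigma_1 g_1 + \dots + \sigma_s g_s \mid \sigma_0,\dots,\sigma_s \in \sum \mathbb{R}[\bar X]^2\}$. It is archimedean if there exists $N \in \mathbb{R}_{>0}$ with $N - X_1^2 - \dots - X_n^2 \in M(g_1,\dots,g_s)$. Similarly, $M_{\mathbb{R}[\bar X,Y]}(g_1,\dots,g_s) = \{\sigma_0 + \sigma_1 g_1 + \dots + \sigma_s g_s \mid \sigma_0,\dots,\sigma_s \in \sum \mathbb{R}[\bar X,Y]^2\}$. A polynomial $f \in \mathbb{R}[\bar X, Y]$ with $m = \deg_Y f$ is fully $m$-ic on $S$ if for every $\bar x \in S$ the univariate polynomial $f(\bar x, Y) \in \mathbb{R}[Y]$ has degree $m$. For $f = \sum_{0 \le i \le m} f_i(\bar X) Y^i \in \mathbb{R}[\bar X, Y]$ with $f_m \ne 0$, $\bar f = \sum_{0 \le i \le m} f_i(\bar X) Y^i Z^{m-i} \in \mathbb{R}[\bar X, Y, Z]$ is its homogenization with respect to $Y$. Also $C = \{(y,z) \in \mathbb{R}^2 \mid y^2 + z^2 = 1\}$. Norm: writing $$f = \sum_{0 \le i \le m}\ \sum_{\alpha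 \in \mathbb{N}_0^n,\, |\alpha| \le d} \binom{|\alpha|}{\alpha} a_{\alpha,i} \bar X^\alpha Y^i,$$ where $|\alpha| = \alpha_1 + \dots + \alpha_n$ and $\binom{|\alpha|}{\alpha} = \frac{|\alpha|!}{\alpha_1! \cdots \alpha_n!}$, set $\|f\|_{\bullet} = \max\{|a_{\alpha,i}| \mid 0 \le i \le m,\ \alpha \in \mathbb{N}_0^n,\ |\alpha| \le d\}$. *)

(* Defs.v *)
(* mpoly has to be imported before the MathComp-Analysis files: their notations
   clash in the other order. *)
From mathcomp Require Import all_boot all_order all_algebra.
From mathcomp Require Import mpoly.
From mathcomp Require Import classical_sets reals.

Set Implicit Arguments.
Unset Strict Implicit.
Unset Printing Implicit Defensive.

Import Order.TTheory GRing.Theory Num.Theory.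

Local Open Scope classical_set_scope.
Local Open Scope ring_scope.

Definition sum_of_squares (A : comNzRingType) (a : A) : Prop :=
  exists l : seq A, a = \sum_(p <- l) p ^+ 2.

Definition quadratic_module (A : comNzRingType) (s : nat) (g : 'I_s -> A) :
    set A :=
  [set p | exists (sigma0 : A) (sigma : 'I_s -> A),
     [/\ sum_of_squares sigma0, (forall i, sum_of_squares (sigma i))
       & p = sigma0 + \sum_(i < s) sigma i * g i]].

Definition archimedean (R : realType) (n s : nat) (g : 'I_s -> {mpoly R[n]}) :
    Prop :=
  exists2 N : R, 0 < N &
    quadratic_module g (N%:MP - \sum_(i < n) 'X_i ^+ 2).

Definition nonneg_set (R : realType) (n s : nat) (g : 'I_s -> {mpoly R[n]}) :
    set ('I_n -> R) :=
  [set x | forall i, 0 <= (g i).@[x]].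

(* R[X_1, ..., X_n, Y] is represented as R[X_1, ..., X_n][Y]: the coefficient
   f`_i is the polynomial f_i(X) in f = \sum_i f_i(X) Y^i. All degrees below
   are 0 on the zero polynomial. *)
Section TwoKindsOfVariables.
Context {R : realType} {n : nat}.
Implicit Types (f : {poly {mpoly R[n]}}) (x : 'I_n -> R) (y z : R).

Definition degY f : nat := (size f).-1.

Definition degX f : nat := \max_(i < size f) (msize f`_i).-1.

Definition tdeg f : nat :=
  \max_(i < size f | f`_i != 0) ((msize f`_i).-1 + i)%N.

Definition specX x f : {poly R} := map_poly (meval x) f.

Definition evalXY x y f : R := (specX x f).[y].

(* Having degree m is expressed by size m.+1, so that (unlike for degY) the zero
   polynomial does not have degree 0. *)
Definition fully_ic (m : nat) (S : set ('I_n -> R)) f : Prop :=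
  forall x, S x -> size (specX x f) = m.+1.

(* The homogenization with respect to Y, as an element of R[X, Y][Z]. *)
Definition homogY f : {poly {poly {mpoly R[n]}}} :=
  \sum_(i < (degY f).+1) ((f`_i)%:P * 'X^i)%:P * 'X^(degY f - i).

Definition evalXYZ x y z (F : {poly {poly {mpoly R[n]}}}) : R :=
  (map_poly (evalXY x y) F).[z].

(* The values taken by the homogenization on S x C, C being the unit circle. *)
Definition circle_values (S : set ('I_n -> R)) f : set R :=
  [set evalXYZ w.1 w.2.1 w.2.2 (homogY f) |
     w in [set w : ('I_n -> R) * (R * R) |
             S w.1 /\ w.2.1 ^+ 2 + w.2.2 ^+ 2 = 1]].

(* |alpha|! / (alpha_1! ... alpha_n!), as an element of R. *)
Definition multinomial (alpha : 'X_{1..n}) : R :=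
  (mdeg alpha)`!%:R / \prod_(i < n) (alpha i)`!%:R.

(* 'X_{1..n < d.+1} is the finite type of exponents alpha with |alpha| <= d. *)
Definition bullet_norm f : R :=
  \big[Num.max/0]_(i < (degY f).+1)
    \big[Num.max/0]_(alpha : 'X_{1..n < (degX f).+1})
      `|(f`_i)@_alpha / multinomial alpha|.

End TwoKindsOfVariables.

Definition is_min (R : realType) (A : set R) (a : R) : Prop :=
  A a /\ lbound A a.

(* Main.v *)
(* Dividing f(x, y) by w(y) = (1 + y^2)^(m/2), which is a polynomial since f
   positive on S x C forces m to be even, turns the minimum on S x C into the bound
   fmin * w(y) <= f(x, y) on S x R, and the coefficients of f(., y) are bounded by
   multiples of w(y). So f is a family of polynomials in x, positive on S
   uniformly in y, and any certificate that is linear in its coefficients can be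
   applied with y as a parameter; its multipliers, nonnegative on R, are then sums
   of squares in R[Y].

   The certificate is found on a large cube Q = [-r, r]^n instead of S. By a
   Lojasiewicz inequality, obtained from quantifier elimination, points of Q far
   from S violate some g_i >= 0 polynomially in the distance. Hence, for lambda and
   k polynomial in the data, f - lambda * w * sum_i (1 - g_i/c)^(2k) g_i is still
   bounded below by fmin * w / 4 on Q. Its Bernstein coefficients of degree N on Q
   are then nonnegative, N being the exponential in the final bound.

   The Bernstein basis is made of products of r + X_i and r - X_i. With r^2 large
   enough, these lie in the quadratic module generated by the single element
   r^2 - sum X_i^2, which is closed under products and contained in the
   archimedean module M(g_1, ..., g_s), so that Putinar's theorem is not needed. *)
Require Import Defs.
From mathcomp Require Import all_boot all_order all_algebra.
From mathcomp Require Import ssrcomplements mpoly.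
From mathcomp Require Import ordered_qelim qe_rcf polyrcf ring lra zify.
From mathcomp Require Import boolp classical_sets cardinality reals.
From mathcomp Require Import topology normedtype derive realfun sequences exp.

Import Order.TTheory GRing.Theory Num.Theory.
Import numFieldNormedType.Exports.

Local Open Scope classical_set_scope.
Local Open Scope ring_scope.

(** * Sums of squares and nonnegative univariate polynomials *)

Section SumsOfSquares.
Context {A : comNzRingType}.
Implicit Types a b : A.

Lemma sos_sqr a : sum_of_squares (a ^+ 2).
Proof. by exists [:: a]; rewrite big_seq1. Qed.

Lemma sos0 : sum_of_squares (0 : A).
Proof. by exists [::]; rewrite big_nil. Qed.

Lemma sos1 : sum_of_squares (1 : A).
Proof. by rewrite -(expr1n _ 2); exact: sos_sqr. Qed.

Lemma sosD a b : sum_of_squares a -> sum_of_squares b -> sum_of_squares (a + b).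
Proof. by move=> [l ->] [l' ->]; exists (l ++ l'); rewrite big_cat. Qed.

Lemma sosM a b : sum_of_squares a -> sum_of_squares b -> sum_of_squares (a * b).
Proof.
move=> [l ->] [l' ->]; exists [seq p * q | p <- l, q <- l'].
rewrite big_allpairs_dep mulr_suml; apply: eq_bigr => p _.
by rewrite mulr_sumr; apply: eq_bigr => q _; rewrite exprMn.
Qed.

Lemma sosX a k : sum_of_squares a -> sum_of_squares (a ^+ k).
Proof.
move=> sa; elim: k => [|k IHk]; first by rewrite expr0; exact: sos1.
by rewrite exprS; exact: sosM.
Qed.

Lemma sos_sum (I : Type) (r : seq I) (P : pred I) (F : I -> A) :
  (forall i, P i -> sum_of_squares (F i)) ->
  sum_of_squares (\sum_(i <- r | P i) F i).
Proof.
by move=> sF; elim/big_ind: _ => //; [exact: sos0 | exact: sosD].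
Qed.

Lemma sos_rmorph (B : comNzRingType) (phi : {rmorphism A -> B}) a :
  sum_of_squares a -> sum_of_squares (phi a).
Proof.
move=> [l ->]; exists (map phi l); rewrite big_map rmorph_sum.
by apply: eq_bigr => p _; rewrite rmorphXn.
Qed.

End SumsOfSquares.

Lemma sos_ge0 {R : rcfType} (c : R) : 0 <= c -> sum_of_squares c.
Proof. by move=> c0; rewrite -(sqr_sqrtr c0); exact: sos_sqr. Qed.

Section NonnegativePolynomials.
Context {R : realType}.
Implicit Types (p q : {poly R}) (a x : R).

Lemma poly_ge0_right p a : (forall x, a < x -> 0 <= p.[x]) -> 0 <= p.[a].
Proof.
move=> p_ge0; case: (leP 0 p.[a]) => // pa_lt0.
have e0 : 0 < - p.[a] by rewrite oppr_gt0.
have [d d0 /(_ (a + d / 2))] := poly_cont a p e0.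
have ad : a < a + d / 2 by rewrite ltrDl divr_gt0.
have := p_ge0 _ ad; set u := p.[_] => u0.
have -> : a + d / 2 - a = d / 2 by ring.
rewrite gtr0_norm ?divr_gt0 // => /(_ _); rewrite ltr_norml.
have -> : d / 2 < d by lra.
by move=> /(_ isT); lra.
Qed.

Lemma poly_ge0_left p a : (forall x, x < a -> 0 <= p.[x]) -> 0 <= p.[a].
Proof.
move=> p_ge0; have := @poly_ge0_right (p \Po - 'X) (- a).
rewrite !horner_comp !hornerE opprK; apply=> x ax.
by rewrite !horner_comp !hornerE; apply: p_ge0; rewrite ltrNl.
Qed.

Lemma lead_coef_ge0 p : (forall x, 0 <= p.[x]) -> 0 <= lead_coef p.
Proof.
move=> p_ge0; rewrite leNgt; apply/negP => lc_lt0.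
have [|z /(_ z (lexx z))] := @poly_pinfty_gt_lc _ (- p).
  by rewrite lead_coefN oppr_gt0.
rewrite lead_coefN hornerN; have := p_ge0 z; lra.
Qed.

Lemma poly_coercive p b : (forall x, 0 <= p.[x]) -> (1 < size p)%N ->
  exists z, forall x, z <= x -> b <= p.[x].
Proof.
move=> p_ge0 p_gt1; pose q := p - b%:P.
have lcq : lead_coef q = lead_coef p.
  by rewrite lead_coefDl // size_polyN (leq_ltn_trans (size_polyC_leq1 _)).
have [|z zP] := @poly_pinfty_gt_lc _ q.
  rewrite lcq lt_neqAle lead_coef_ge0 // andbT eq_sym lead_coef_eq0.
  by rewrite -size_poly_gt0 ltnW.
exists z => x /zP; rewrite lcq !hornerE => h.
by have := lead_coef_ge0 p p_ge0; lra.
Qed.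

(** Coercivity at both ends, the left one through [p \Po - 'X], confines the search to a compact
    interval containing 0: outside it [p] is already at least [p.[0]]. *)
Lemma poly_min p : (forall x, 0 <= p.[x]) -> exists a, forall x, p.[a] <= p.[x].
Proof.
move=> p_ge0; case: (leqP (size p) 1) => [/size1_polyC ->|p_gt1].
  by exists 0 => x; rewrite !hornerC.
have [z1 z1P] := poly_coercive p p.[0] p_ge0 p_gt1.
have [||z2 z2P] := poly_coercive (p \Po - 'X) p.[0].
- by move=> x; rewrite horner_comp !hornerE.
- by rewrite size_comp_poly2 // size_polyN size_polyX.
pose z := Num.max 0 (Num.max z1 z2).
have z0 : 0 <= z by rewrite le_max lexx.
have [||a _ aP] := @EVT_min R (horner p) (- z) z.
- lra.
- exact: (continuous_subspaceT (@continuous_horner R p)).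
exists a => x; have pa0 : p.[a] <= p.[0] by apply: aP; rewrite in_itv /=; lra.
case: (lerP x z) => [xz|zx]; last first.
  apply: (le_trans pa0); apply: z1P; apply: le_trans (ltW zx).
  by rewrite !le_max lexx orbT.
case: (lerP (- z) x) => [zx|xz']; first by apply: aP; rewrite in_itv /= zx.
apply: (le_trans pa0); have := z2P (- x); rewrite horner_comp !hornerE opprK.
apply; have : z2 <= z by rewrite !le_max lexx !orbT.
by lra.
Qed.

(** Induction on the degree. After subtraction of the minimum value, attained at [a], the remainder
    has a double root at [a], and its cofactor is again nonnegative. *)
Lemma nonneg_poly_sos p : (forall x, 0 <= p.[x]) -> sum_of_squares p.
Proof.
elim/ltn_ind: {p}(size p) {-2}p (erefl (size p)) => k IHk p szp p_ge0.
have [a aP] := poly_min p p_ge0.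
have sosC (c : R) : 0 <= c -> sum_of_squares c%:P.
  by move=> /sos_ge0; exact: (sos_rmorph _ (@polyC R)).
case: (leqP (size p) 1) => [/size1_polyC sz1|p_gt1].
  by rewrite sz1; apply: sosC; have := p_ge0 0; rewrite {1}sz1 hornerC.
have /factor_theorem[q pq] : root (p - p.[a]%:P) a.
  by rewrite /root !hornerE subrr.
have qE x : q.[x] * (x - a) = p.[x] - p.[a].
  by have /(congr1 (horner^~ x)) := pq; rewrite !hornerE.
(* Since [q.[x] * (x - a)] is nonnegative, [q] is nonnegative to the right of [a] and nonpositive to
   the left; continuity leaves only 0 at [a]. *)
have qa0 : q.[a] = 0.
  apply/eqP; rewrite eq_le; apply/andP; split; last first.
    apply: poly_ge0_right => x ax; rewrite -(pmulr_lge0 _ (_ : 0 < x - a)).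
      by rewrite qE subr_ge0.
    by rewrite subr_gt0.
  rewrite -oppr_ge0 -hornerN; apply: poly_ge0_left => x ax.
  rewrite hornerN -(pmulr_lge0 _ (_ : 0 < a - x)) ?subr_gt0 //.
  by rewrite mulNr -mulrN opprB qE subr_ge0.
have /factor_theorem[q' qq'] : root q a by rewrite /root qa0.
have q'E x : q'.[x] * (x - a) ^+ 2 = p.[x] - p.[a].
  by rewrite -qE qq' hornerM hornerXsubC -mulrA -expr2.
have pE : p = (p.[a])%:P + q' * ('X - a%:P) ^+ 2.
  by rewrite expr2 mulrA -qq' -pq addrC subrK.
have q'_ge0 x : 0 <= q'.[x].
  have h y : y != a -> 0 <= q'.[y].
    move=> ya; rewrite -(pmulr_lge0 _ (_ : 0 < (y - a) ^+ 2)).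
      by rewrite q'E subr_ge0.
    by rewrite exprn_even_gt0 //= subr_eq0.
  case: (eqVneq x a) => [->|/h //].
  by apply: poly_ge0_right => y ay; apply: h; rewrite gt_eqF.
rewrite pE; apply: sosD; first exact: sosC.
apply: sosM; last exact: sos_sqr.
apply: (IHk (size q')) => //.
case: (eqVneq q' 0) => [->|q'0]; first by rewrite size_poly0 -szp (ltnW p_gt1).
have : size (p - p.[a]%:P) = size p.
  by rewrite size_polyDl // size_polyN (leq_ltn_trans (size_polyC_leq1 _)).
rewrite pq qq' -mulrA -expr2 size_Mmonic ?monic_exp ?monicXsubC //.
rewrite size_exp_XsubC => h; rewrite -szp -h addnS addn2 ltnS; exact: leqnSn.
Qed.

End NonnegativePolynomials.

(** * A Lojasiewicz inequality *)

Section SignNearZero.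
Context {R : realType}.
Implicit Types (c : {poly R}) (p q : {poly {poly R}}) (e t : R).

Lemma poly_unit_bound c :
  exists2 B, 0 < B & forall e, 0 <= e <= 1 -> `|c.[e]| <= B.
Proof.
elim/poly_ind: c => [|c a [B B0 BP]].
  by exists 1 => // e _; rewrite horner0 normr0.
exists (B + `|a|) => [|e e01]; first by rewrite ltr_pwDl.
rewrite !hornerE (le_trans (ler_normD _ _)) // lerD2r normrM.
have /andP[e0 e1] := e01.
by rewrite -[B]mulr1 ler_pM ?BP // ger0_norm.
Qed.

Lemma poly2_unit_bound p : exists2 B, 0 < B &
  forall t e, 0 <= t <= 1 -> 0 <= e <= 1 -> `|p.[t%:P].[e]| <= B.
Proof.
elim/poly_ind: p => [|p c [B B0 BP]].
  by exists 1 => // t e _ _; rewrite !horner0 normr0.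
have [C C0 CP] := poly_unit_bound c.
exists (B + C) => [|t e t01 e01]; first by rewrite addr_gt0.
rewrite hornerMXaddC hornerD hornerM hornerC.
rewrite (le_trans (ler_normD _ _)) // lerD ?CP // normrM.
have /andP[t0 t1] := t01.
by rewrite -[B]mulr1 ler_pM ?BP // ger0_norm.
Qed.

Lemma sgr_perturb (a b : R) : `|b| < `|a| -> Num.sg (b + a) = Num.sg a.
Proof.
case: (ltrgt0P a) => [a0|a0|->]; last by rewrite ltNge normr_ge0.
  by rewrite ltr_norml => /andP[h _]; rewrite !gtr0_sg //; lra.
by rewrite ltr_norml => /andP[_ h]; rewrite !ltr0_sg //; lra.
Qed.

(** The lowest nonzero coefficient dominates for small [e]; [v] is its index, found by Horner
    induction. *)
Lemma poly_sign_near0 c : c != 0 ->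
  exists v : nat, exists k e0 s : R, [/\ 0 < k, 0 < e0 &
    forall e, 0 < e < e0 -> Num.sg c.[e] = s /\ k * e ^+ v <= `|c.[e]|].
Proof.
elim/poly_ind: c => [|c a IHc]; first by rewrite eqxx.
case: (eqVneq a 0) => [-> {a}|a0 _].
  rewrite addr0 => cX0; have c0 : c != 0.
    by apply: contraNneq cX0 => ->; rewrite mul0r.
  have [v [k [e0 [s [k0 e00 H]]]]] := IHc c0.
  exists v.+1, k, e0, s; split=> // e /[dup] /andP[ee _] /H[sE kE].
  rewrite hornerMX sgrM sE gtr0_sg // mulr1; split=> //.
  by rewrite normrM (gtr0_norm ee) exprSr mulrA ler_pM2r.
have [B B0 BP] := poly_unit_bound c.
have na0 : 0 < `|a| by rewrite normr_gt0.
exists 0, (`|a| / 2), (Num.min 1 (`|a| / (2 * B))), (Num.sg a).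
have e00 : 0 < `|a| / (2 * B) by rewrite divr_gt0 // mulr_gt0.
split; first exact: divr_gt0.
  by rewrite lt_min ltr01.
move=> e /andP[ee]; rewrite lt_min => /andP[e1 eB].
have h : `|c.[e] * e| < `|a| / 2.
  rewrite normrM (gtr0_norm ee).
  apply: (@le_lt_trans _ _ (B * e)).
    by rewrite ler_pM2r // BP // (ltW ee) ltW.
  move: eB; rewrite ltr_pdivlMr ?mulr_gt0 //; lra.
rewrite hornerMXaddC; split; first by rewrite sgr_perturb //; lra.
rewrite expr0 mulr1 [c.[e] * e + a]addrC.
have := lerB_normD a (c.[e] * e); lra.
Qed.

(** Below the curve t = e^N the lowest nonzero coefficient in t decides the sign: it is at least
    [k * e ^+ v] in absolute value, while the rest is at most [B * t] with t < e^(v+1) and e <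
    k/B. *)
Lemma poly2_sign_near0 p : exists N : nat, exists e0 s : R, 0 < e0 /\
  forall e t, 0 < e < e0 -> 0 < t < e ^+ N -> Num.sg p.[t%:P].[e] = s.
Proof.
elim/poly_ind: p => [|p c [N [e0 [s [e00 H]]]]].
  by exists 0%N, 1, 0; split=> // e t _ _; rewrite !horner0 sgr0.
case: (eqVneq c 0) => [->|c0].
  exists N, e0, s; split=> // e t he ht; rewrite addr0 hornerMX hornerM hornerC.
  by rewrite sgrM (H e t) // gtr0_sg ?mulr1 //; case/andP: ht.
have [v [k [e1 [s' [k0 e10 H']]]]] := poly_sign_near0 c c0.
have [B B0 BP] := poly2_unit_bound p.
exists v.+1, (Num.min 1 (Num.min e1 (k / B))), s'; split.
  by rewrite !lt_min ltr01 e10 divr_gt0.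
move=> e t /andP[ee]; rewrite !lt_min => /and3P[lt1 lte1 ltk] /andP[t0 tN].
have [|<- kE] := H' e; first by rewrite ee.
rewrite hornerMXaddC hornerD hornerM hornerC sgr_perturb //.
apply: lt_le_trans kE; rewrite normrM (gtr0_norm t0).
have ev0 : 0 < e ^+ v by rewrite exprn_gt0.
have ev1 : e ^+ v <= 1 by rewrite exprn_ile1 // ltW.
have t1 : t <= 1.
  by apply: (le_trans (ltW tN)); rewrite exprn_ile1 // ltW.
apply: (@le_lt_trans _ _ (B * t)).
  by rewrite ler_pM2r // BP ?(ltW ee) ?(ltW t0) ?t1 // ltW.
move: ltk; rewrite ltr_pdivlMr // => ltk.
move: tN; rewrite exprSr => tN; nra.
Qed.

End SignNearZero.

(** * First-order properties are constant on thin regions 0 < t < e^N *)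

Section SemialgebraicGerms.
Context {R : realType}.
Implicit Types (t : GRing.term R) (f : ord.formula R).

(* The variable 0 becomes the main variable, the variable 1 the coefficient variable. *)
Fixpoint poly2_of_term t : {poly {poly R}} :=
  match t with
  | GRing.Var 0 => 'X
  | GRing.Var 1 => 'X%:P
  | GRing.Var _ => 0
  | GRing.Const r => r%:P%:P
  | GRing.NatConst n => n%:R
  | GRing.Add t1 t2 => poly2_of_term t1 + poly2_of_term t2
  | GRing.Opp t1 => - poly2_of_term t1
  | GRing.NatMul t1 n => poly2_of_term t1 *+ n
  | GRing.Mul t1 t2 => poly2_of_term t1 * poly2_of_term t2
  | GRing.Inv _ => 0
  | GRing.Exp t1 n => poly2_of_term t1 ^+ n
  end.

Lemma poly2_of_termE t (x e : R) : GRing.rterm t ->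
  GRing.eval [:: x; e] t = (poly2_of_term t).[x%:P].[e].
Proof.
elim: t => //=.
- by case=> [|[|k]] _ /=; rewrite ?hornerX ?hornerC ?hornerX ?horner0 ?nth_nil.
- by move=> r _; rewrite !hornerC.
- by move=> k _; rewrite -!polyC_natr !hornerC.
- by move=> t1 IH1 t2 IH2 /andP[/IH1 -> /IH2 ->]; rewrite !hornerD.
- by move=> t1 IH1 /IH1 ->; rewrite !hornerN.
- by move=> t1 IH1 k /IH1 ->; rewrite !hornerMn.
- by move=> t1 IH1 t2 IH2 /andP[/IH1 -> /IH2 ->]; rewrite !hornerM.
- by move=> t1 IH1 k /IH1 ->; rewrite !horner_exp.
Qed.

(** Atoms are sign conditions on one polynomial in two variables, handled by [poly2_sign_near0];
    connectives take the larger exponent and the smaller range of [e]. *)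
Lemma formula_const_near0 f : ord.qf_form f -> ord.rformula f ->
  exists N : nat, exists2 e0 : R, 0 < e0 &
  forall e x y, 0 < e < e0 -> 0 < x < e ^+ N -> 0 < y < e ^+ N ->
    ord.qf_eval [:: x; e] f = ord.qf_eval [:: y; e] f.
Proof.
(* [b'] reads the comparison off the sign of the difference, so that equality, < and <= are treated
   at once. *)
have atom t1 t2 (b : rel R) (b' : R -> bool) :
    (forall u v, b u v = b' (Num.sg (v - u))) ->
    GRing.rterm t1 && GRing.rterm t2 ->
    exists N : nat, exists2 e0 : R, 0 < e0 &
    forall e x y, 0 < e < e0 -> 0 < x < e ^+ N -> 0 < y < e ^+ N ->
    b (GRing.eval [:: x; e] t1) (GRing.eval [:: x; e] t2) =
    b (GRing.eval [:: y; e] t1) (GRing.eval [:: y; e] t2).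
  move=> bE /andP[r1 r2].
  have [N [e0 [s [e00 H]]]] := poly2_sign_near0 (poly2_of_term t2 - poly2_of_term t1).
  exists N, e0 => // e x y he hx hy.
  have h z : 0 < z < e ^+ N ->
      Num.sg (GRing.eval [:: z; e] t2 - GRing.eval [:: z; e] t1) = s.
    by move=> hz; rewrite !poly2_of_termE // -(H e z) // !hornerD !hornerN.
  by rewrite !bE !h.
have comb f1 f2 (b : bool -> bool -> bool) :
  (exists N : nat, exists2 e0 : R, 0 < e0 &
   forall e x y, 0 < e < e0 -> 0 < x < e ^+ N -> 0 < y < e ^+ N ->
    ord.qf_eval [:: x; e] f1 = ord.qf_eval [:: y; e] f1) ->
  (exists N : nat, exists2 e0 : R, 0 < e0 &
   forall e x y, 0 < e < e0 -> 0 < x < e ^+ N -> 0 < y < e ^+ N ->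
    ord.qf_eval [:: x; e] f2 = ord.qf_eval [:: y; e] f2) ->
  (exists N : nat, exists2 e0 : R, 0 < e0 &
   forall e x y, 0 < e < e0 -> 0 < x < e ^+ N -> 0 < y < e ^+ N ->
    b (ord.qf_eval [:: x; e] f1) (ord.qf_eval [:: x; e] f2) =
    b (ord.qf_eval [:: y; e] f1) (ord.qf_eval [:: y; e] f2)).
  move=> [N1 [e1 e10 H1]] [N2 [e2 e20 H2]].
  (* The cap at 1 makes [e ^+ N] decrease with [N], so that the larger exponent serves both
     subformulas. *)
  exists (maxn N1 N2), (Num.min 1 (Num.min e1 e2)).
    by rewrite !lt_min ltr01 e10.
  move=> e x y /andP[e0]; rewrite !lt_min => /and3P[l1 l2 l3].
  have le N : (N <= maxn N1 N2)%N -> e ^+ maxn N1 N2 <= e ^+ N.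
    by move=> ?; rewrite ler_wiXn2l ?ltW.
  move=> /andP[x0 xN] /andP[y0 yN].
  by rewrite (H1 e x y) ?(H2 e x y) ?e0 ?x0 ?y0 ?l2 ?l3 //= 
    (lt_le_trans _ (le _ _)) ?leq_maxl ?leq_maxr.
elim: f => //=.
- by move=> b _ _; exists 0%N, 1.
- move=> t1 t2 _; apply: (atom _ _ _ (fun s => s == 0)) => u v.
  by rewrite sgr_eq0 subr_eq0 eq_sym.
- move=> t1 t2 _; apply: (atom _ _ _ (fun s => 0 < s)) => u v.
  by rewrite sgr_gt0 subr_gt0.
- move=> t1 t2 _; apply: (atom _ _ _ (fun s => 0 <= s)) => u v.
  by rewrite sgr_ge0 subr_ge0.
- move=> f1 IH1 f2 IH2 /andP[q1 q2] /andP[r1 r2].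
  exact: (comb _ _ andb (IH1 q1 r1) (IH2 q2 r2)).
- move=> f1 IH1 f2 IH2 /andP[q1 q2] /andP[r1 r2].
  exact: (comb _ _ orb (IH1 q1 r1) (IH2 q2 r2)).
- move=> f1 IH1 f2 IH2 /andP[q1 q2] /andP[r1 r2].
  exact: (comb _ _ implb (IH1 q1 r1) (IH2 q2 r2)).
- move=> f1 IH1 q1 r1.
  exact: (comb _ _ (fun b _ => ~~ b) (IH1 q1 r1) (IH1 q1 r1)).
Qed.

Lemma holds_const_near0 f : ord.rformula f ->
  exists N : nat, exists2 e0 : R, 0 < e0 &
  forall e x y, 0 < e < e0 -> 0 < x < e ^+ N -> 0 < y < e ^+ N ->
    ord.holds [:: x; e] f -> ord.holds [:: y; e] f.
Proof.
move=> rf; have /andP[qf rqf] := ord.quantifier_elim_wf (@wf_QE_wproj R) rf.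
have [N [e0 e00 H]] := formula_const_near0 _ qf rqf.
exists N, e0 => // e x y he hx hy.
move=> /(ord.quantifier_elim_rformP (@wf_QE_wproj R) (@valid_QE_wproj R) _ rf) h.
apply/(ord.quantifier_elim_rformP (@wf_QE_wproj R) (@valid_QE_wproj R) _ rf).
by rewrite -(H e x y).
Qed.

End SemialgebraicGerms.

(** * Building first-order formulas about points of affine space *)

Section Formulas.
Context {R : realType}.
Implicit Types (env : seq R) (f : ord.formula R).

Definition big_and (fs : seq (ord.formula R)) := foldr ord.And (ord.Bool true) fs.
Definition big_or (fs : seq (ord.formula R)) := foldr ord.Or (ord.Bool false) fs.

Lemma holds_big_and env (I : finType) (F : I -> ord.formula R) :
  ord.holds env (big_and [seq F i | i : I]) <-> (forall i, ord.holds env (F i)).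
Proof.
suff h s : ord.holds env (big_and (map F s)) <->
    (forall i, i \in s -> ord.holds env (F i)).
  by split=> [/h Fs i|Fs]; [apply: Fs; rewrite mem_enum | apply/h].
elim: s => [|j s IHs] //=; split.
  by move=> [Fj /IHs Fs] i; rewrite inE => /predU1P[->|/Fs].
move=> Fs; split; first by apply: Fs; exact: mem_head.
by apply/IHs => i si; apply: Fs; rewrite inE si orbT.
Qed.

Lemma holds_big_or env (I : finType) (F : I -> ord.formula R) :
  ord.holds env (big_or [seq F i | i : I]) <-> (exists i, ord.holds env (F i)).
Proof.
suff h s : ord.holds env (big_or (map F s)) <->
    (exists2 i, i \in s & ord.holds env (F i)).
  split=> [/h[i _ Fi]|[i Fi]]; first by exists i.
  by apply/h; exists i; rewrite ?mem_enum.
elim: s => [|j s IHs] /=; first by split=> // -[].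
split=> [[Fj|/IHs[i si Fi]]|[i]]; first by exists j => //; exact: mem_head.
  by exists i => //; rewrite inE si orbT.
by rewrite inE => /predU1P[->|si Fi]; [left | right; apply/IHs; exists i].
Qed.

Lemma rformula_big_and (I : Type) (F : I -> ord.formula R) (s : seq I) :
  (forall i, ord.rformula (F i)) -> ord.rformula (big_and (map F s)).
Proof. by move=> rF; elim: s => //= i s ->; rewrite rF. Qed.

Lemma rformula_big_or (I : Type) (F : I -> ord.formula R) (s : seq I) :
  (forall i, ord.rformula (F i)) -> ord.rformula (big_or (map F s)).
Proof. by move=> rF; elim: s => //= i s ->; rewrite rF. Qed.

Fixpoint exists_block (k n : nat) f :=
  if n is n'.+1 then ord.Exists k (exists_block k.+1 n' f) else f.

Lemma rformula_exists_block k n f :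
  ord.rformula f -> ord.rformula (exists_block k n f).
Proof. by move=> rf; elim: n k => //= n IHn k; exact: IHn. Qed.

(** The block starts at index [size env], so each quantified value is appended at the end of the
    environment. *)
Lemma holds_exists_block n f env : ord.holds env (exists_block (size env) n f) <->
  exists v : 'I_n -> R, ord.holds (env ++ codom v) f.
Proof.
have set_nth_size (l : seq R) x : set_nth 0 l (size l) x = rcons l x.
  by rewrite set_nthE ltnn subnn cats1.
elim: n env => [|n IHn] env /=.
  split=> [h|[v]]; last by rewrite codomE enum_ord0 cats0.
  by exists (fun=> 0); rewrite codomE enum_ord0 cats0.
have codomS (v : 'I_n.+1 -> R) : codom v = v ord0 :: codom (v \o lift ord0).
  by rewrite !codomE enum_ordSl /= -map_comp.
split=> [[x]|[v]].
  rewrite set_nth_size -{1}(size_rcons env x) => /IHn[v hv].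
  exists (fun i => oapp v x (unlift ord0 i)); rewrite codomS unlift_none /=.
  rewrite -cat_rcons (_ : codom (_ \o _) = codom v) //; apply: eq_codom => i /=.
  by rewrite liftK.
rewrite codomS -cat_rcons => hv; exists (v ord0); rewrite set_nth_size.
by rewrite -(size_rcons env (v ord0)); apply/IHn; exists (v \o lift ord0).
Qed.

(** The offset [k] places X_i at variable [k + i], so that the same polynomial can be read at either
    of the two points occurring in a formula. *)
Definition term_of_mpoly (k : nat) {n} (p : {mpoly R[n]}) : GRing.term R :=
  foldr GRing.Add (GRing.NatConst R 0)
    [seq GRing.Mul (GRing.Const p@_m)
       (foldr GRing.Mul (GRing.NatConst R 1)
          [seq GRing.Exp (GRing.Var R (k + i)) (m i) | i : 'I_n]) | m <- msupp p].

Lemma rterm_of_mpoly k n (p : {mpoly R[n]}) : GRing.rterm (term_of_mpoly k p).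
Proof.
rewrite /term_of_mpoly; elim: (msupp p) => //= m ms ->; rewrite andbT.
by rewrite /image_mem; elim: (enum _).
Qed.

Lemma eval_term_of_mpoly env k n (p : {mpoly R[n]}) :
  GRing.eval env (term_of_mpoly k p) = p.@[fun i => env`_(k + i)].
Proof.
rewrite mevalE /term_of_mpoly; elim: (msupp p) => [|m ms IHms] /=.
  by rewrite big_nil.
rewrite big_cons -IHms; congr (_ * _ + _).
rewrite /image_mem -big_enum; elim: (enum _) => [|i s IHs] /=.
  by rewrite big_nil.
by rewrite big_cons -IHs.
Qed.

End Formulas.

(** * Almost feasible points far from S, as a first-order condition on (t, e) *)

Section FarPoints.
Context {R : realType} {n s : nat}.
Variables (g : 'I_s -> {mpoly R[n]}) (r : R).
Implicit Types (x y : 'I_n -> R) (t e : R).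

(** A counterexample to the inequality to be proved: violation at most [t], yet distance at least
    [e] from S in the maximum norm. *)
Definition far_point t e := exists x, [/\ forall i, - r <= x i <= r,
  forall j, - t <= (g j).@[x] &
  forall y, nonneg_set g y -> exists i, e <= `|x i - y i|].

Definition mem_formula k :=
  big_and [seq ord.Le (GRing.NatConst R 0) (term_of_mpoly k (g j)) | j : 'I_s].

(** Absolute values are not terms, so both sides are squared; this is faithful for [e >= 0]. *)
Definition apart_formula : ord.formula R :=
  big_or [seq ord.Le (GRing.Exp (GRing.Var R 1) 2)
    (GRing.Exp (GRing.Add (GRing.Var R (2 + i))
       (GRing.Opp (GRing.Var R (2 + n + i)))) 2) | i : 'I_n].

Definition cube_formula : ord.formula R :=
  big_and [seq ord.And (ord.Le (GRing.Const (- r)) (GRing.Var R (2 + i)))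
                       (ord.Le (GRing.Var R (2 + i)) (GRing.Const r)) | i : 'I_n].

Definition relaxed_formula : ord.formula R :=
  big_and [seq ord.Le (GRing.Opp (GRing.Var R 0)) (term_of_mpoly 2 (g j)) | j : 'I_s].

(* Variables: 0 for t, 1 for e, then n variables for x and n variables for y. *)
Definition far_formula : ord.formula R :=
  exists_block 2 n (ord.And (ord.And cube_formula relaxed_formula)
    (ord.Not (exists_block (2 + n) n
       (ord.And (mem_formula (2 + n)) (ord.Not apart_formula))))).

Lemma rformula_far : ord.rformula far_formula.
Proof.
apply: rformula_exists_block => /=; apply/andP; split; first apply/andP; first split.
- exact: rformula_big_and.
- by apply: rformula_big_and => j /=; exact: rterm_of_mpoly.
- apply: rformula_exists_block => /=; apply/andP; split.
    by apply: rformula_big_and => j /=; exact: rterm_of_mpoly.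
  exact: rformula_big_or.
Qed.

Lemma holds_far t e : 0 <= e -> ord.holds [:: t; e] far_formula <-> far_point t e.
Proof.
move=> e0.
have nthX (v : 'I_n -> R) (l : seq R) (i : 'I_n) : ([:: t, e & codom v] ++ l)`_(2 + i) = v i.
  rewrite /= add0n nth_cat size_codom card_ord ltn_ord codomE.
  by rewrite (nth_map i) ?size_enum_ord // nth_ord_enum.
have nthY (v w : 'I_n -> R) (i : 'I_n) :
    ([:: t, e & codom v] ++ codom w)`_(2 + n + i) = w i.
  rewrite /= add0n nth_cat size_codom card_ord ltnNge leq_addr /= addKn codomE.
  by rewrite (nth_map i) ?size_enum_ord // nth_ord_enum.
have nthX0 (v : 'I_n -> R) (i : 'I_n) : [:: t, e & codom v]`_(2 + i) = v i.
  by rewrite -(nthX v [::]) cats0.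
rewrite /far_formula (holds_exists_block n _ [:: t; e]).
(* The universal quantifier over points of S is encoded as a negated existential block, hence the
   double negation around [apart_formula]. *)
have far v : (forall y, nonneg_set g y -> exists i, e <= `|v i - y i|) <->
  ord.holds ([:: t; e] ++ codom v) (ord.Not (exists_block (2 + n) n
       (ord.And (mem_formula (2 + n)) (ord.Not apart_formula)))).
  have sz : (2 + n)%N = size ([:: t; e] ++ codom v).
    by rewrite size_cat size_codom card_ord.
  have atom (w : 'I_n -> R) (i : 'I_n) : ord.holds (([:: t; e] ++ codom v) ++ codom w)
        (ord.Le (GRing.Exp (GRing.Var R 1) 2)
          (GRing.Exp (GRing.Add (GRing.Var R (2 + i))
             (GRing.Opp (GRing.Var R (2 + n + i)))) 2)) <-> e <= `|v i - w i|.
    have -> : e <= `|v i - w i| = (e ^+ 2 <= (v i - w i) ^+ 2).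
      by rewrite -[(v i - w i) ^+ 2]real_normK ?num_real // ler_sqr ?nnegrE.
    by rewrite /ord.holds /GRing.eval nthX nthY.
  have mem (w : 'I_n -> R) : nonneg_set g w <-> ord.holds (([:: t; e] ++ codom v) ++ codom w)
      (mem_formula (2 + n)).
    rewrite holds_big_and; split=> gw j.
      have := gw j; rewrite /ord.holds eval_term_of_mpoly /GRing.eval.
      by rewrite (meval_eq _ (nthY v w)).
    have := gw j; rewrite /ord.holds eval_term_of_mpoly /GRing.eval.
    by rewrite (meval_eq _ (nthY v w)).
  rewrite [X in exists_block X _ _]sz; split.
    move=> hv /(holds_exists_block n _ ([:: t; e] ++ codom v)) [w [/mem Sw far_w]].
    have [i hi] := hv w Sw; apply: far_w; apply/holds_big_or.
    by exists i; apply/atom.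
  move=> hv y Sy; case: (pselect (exists i, e <= `|v i - y i|)) => // no.
  case: hv; apply/(holds_exists_block n _ ([:: t; e] ++ codom v)); exists y.
  split; first exact/mem.
  by move=> /holds_big_or[i /atom hi]; apply: no; exists i.
split=> [[v [[hr hg] hfar]]|[v [hr hg hfar]]]; exists v; split.
- move=> i; move/holds_big_and: hr => /(_ i) [].
  by rewrite /ord.holds /GRing.eval nthX0 => -> ->.
- move=> j; move/holds_big_and: hg => /(_ j).
  by rewrite /ord.holds eval_term_of_mpoly (meval_eq _ (nthX0 v)).
- exact/far.
- split; apply/holds_big_and => i.
    by have /andP[h1 h2] := hr i; split; rewrite /ord.holds /GRing.eval nthX0.
  by rewrite /ord.holds eval_term_of_mpoly (meval_eq _ (nthX0 v)); exact: hg.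
- exact/far.
Qed.
End FarPoints.

Section ContinuousBig.
Context {R : realType} {T : topologicalType} {I : Type}.
Variables (F : I -> T -> R) (r : seq I).
Hypothesis F_cont : forall i, continuous (F i).

Lemma continuous_big_sum : continuous (fun v => \sum_(i <- r) F i v).
Proof.
elim: r => [|i l IHl].
  rewrite (_ : (fun v => _) = (fun=> 0)); first exact: cst_continuous.
  by apply/funext => v; rewrite big_nil.
rewrite (_ : (fun v => _) = F i \+ (fun v => \sum_(i <- l) F i v)).
  by move=> v; apply: continuousD; [exact: F_cont | exact: IHl].
by apply/funext => v; rewrite big_cons.
Qed.

Lemma continuous_big_prod : continuous (fun v => \prod_(i <- r) F i v).
Proof.
elim: r => [|i l IHl].
  rewrite (_ : (fun v => _) = (fun=> 1)); first exact: cst_continuous.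
  by apply/funext => v; rewrite big_nil.
rewrite (_ : (fun v => _) = F i \* (fun v => \prod_(i <- l) F i v)).
  by move=> v; apply: continuousM; [exact: F_cont | exact: IHl].
by apply/funext => v; rewrite big_cons.
Qed.

End ContinuousBig.

(** * Compactness for fixed e, then uniformity in e *)

Section LojasiewiczInequality.
Context {R : realType} {n s : nat}.
Variables (g : 'I_s -> {mpoly R[n]}) (r : R).
Implicit Types (x y : 'I_n -> R) (t e : R).

Lemma continuous_meval (p : {mpoly R[n]}) :
  continuous (fun v : 'rV[R]_n => p.@[v ord0]).
Proof.
rewrite (_ : (fun v => _) =
  (fun v : 'rV[R]_n => \sum_(m <- msupp p) p@_m * \prod_i v ord0 i ^+ m i));
  last by apply/funext => v; rewrite mevalE.
apply: continuous_big_sum => m v.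
apply: continuousM; first exact: cst_continuous.
apply: continuous_big_prod => i w.
apply: (@continuous_comp _ _ _ (fun w : 'rV[R]_n => w ord0 i) (fun z => z ^+ m i)).
  exact: coord_continuous.
exact: exprn_continuous.
Qed.

(** The points of the cube at distance at least [e] from S form a compact set disjoint from S. The
    total violation of the constraints has a positive minimum there, which a far point with small
    [t] would undercut. *)
Lemma not_far_point e : 0 < e -> exists2 t0, 0 < t0 &
  forall t, t < t0 -> ~ far_point g r t e.
Proof.
move=> e0.
pose D := [set v : 'rV[R]_n | (forall i, v ord0 i \in `[- r, r]) /\
  forall y, nonneg_set g y -> exists i, e <= `|v ord0 i - y i|].
have Dcompact : compact D.
  (* [D] is the cube cut by one closed condition for each point of S, and each condition is a finite
     union over the coordinates. *)
  have -> : D = [set v : 'rV[R]_n | forall i, v ord0 i \in `[- r, r]] `&`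
    \bigcap_(y in nonneg_set g) \bigcup_(i in [set: 'I_n])
      [set v : 'rV[R]_n | e <= `|v ord0 i - y i|].
    apply/seteqP; split=> v [v1 v2]; split=> // y Sy.
      by have [i hi] := v2 y Sy; exists i.
    by have [i _ hi] := v2 y Sy; exists i.
  apply: compact_closedI.
    exact: (@rV_compact R n (fun=> `[- r, r]%classic) (fun=> @segment_compact R _ _)).
  apply: closed_bigI => y _; apply: closed_bigcup => [|i _]; first exact: finite_finset.
  apply: (@closed_comp _ _ (fun v : 'rV[R]_n => `|v ord0 i - y i|) [set a | e <= a]).
    have cont : continuous (fun v : 'rV[R]_n => v ord0 i - y i).
      by move=> v; apply: continuousB; [exact: coord_continuous | exact: cst_continuous].
    by move=> v _; exact: (continuous_comp (cont v) (@norm_continuous _ R^o _)).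
  exact: closed_ge.
have [[v0 Dv0]|D0] := pselect (D !=set0); last first.
  exists 1 => // t _ [x [hr hg far]]; apply: D0; exists (\row_i x i); split=> [i|y Sy].
    by rewrite mxE in_itv /=; exact: hr.
  by have [i hi] := far y Sy; exists i; rewrite mxE.
(* [M] is twice the sum of the negative parts of the [g j]: continuous, and zero exactly on S. *)
pose M (v : 'rV[R]_n) := \sum_j (`|(g j).@[v ord0]| - (g j).@[v ord0]).
have Mcont : continuous M.
  apply: continuous_big_sum => j; have cont := continuous_meval (g j).
  have contN : continuous (fun v : 'rV[R]_n => `|(g j).@[v ord0]|).
    by move=> v; exact: (continuous_comp (cont v) (@norm_continuous _ R^o _)).
  by move=> v; exact: (continuousB (contN v) (cont v)).
have [|v Dv vmin] := @EVT_min_rV R n M D (ex_intro _ v0 Dv0) Dcompact.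
  exact: continuous_subspaceT.
have term_ge0 (w : 'rV[R]_n) j : 0 <= `|(g j).@[w ord0]| - (g j).@[w ord0].
  by rewrite subr_ge0 ler_norm.
have M0 : 0 < M v.
  rewrite lt_neqAle sumr_ge0 // andbT eq_sym; apply/negP => /eqP /psumr_eq0P => h.
  have Sv : nonneg_set g (v ord0).
    move=> j; have := h (fun j _ => term_ge0 v j) j isT => /eqP.
    by rewrite subr_eq0 => /eqP <-.
  move: Dv; rewrite inE => -[_ /(_ _ Sv) [i]].
  by rewrite subrr normr0 leNgt e0.
(* At a far point [M] is at most [2 * s * t] if [t > 0]; [s.+1] keeps the divisor nonzero. *)
exists (M v / (2 * s.+1%:R)); first by rewrite divr_gt0 // mulr_gt0.
move=> t tM [x [hr hg far]].
have xD : (\row_i x i : 'rV[R]_n) \in D.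
  rewrite inE; split=> [i|y Sy]; first by rewrite mxE in_itv /=; exact: hr.
  by have [i hi] := far y Sy; exists i; rewrite mxE.
have := vmin _ xD; apply/negP; rewrite -ltNge {1}/M.
have xE j : (g j).@[(\row_i x i : 'rV[R]_n) ord0] = (g j).@[x].
  by apply: meval_eq => i; rewrite mxE.
have t2 j : `|(g j).@[x]| - (g j).@[x] <= 2 * Num.max 0 t.
  have := hg j; have : 0 <= Num.max 0 t by rewrite le_max lexx.
  have : t <= Num.max 0 t by rewrite le_max lexx orbT.
  by case: (ger0P (g j).@[x]); lra.
apply: (@le_lt_trans _ _ (\sum_(j < s) 2 * Num.max 0 t)).
  by apply: ler_sum => j _; rewrite xE.
rewrite sumr_const card_ord -[_ *+ s]mulr_natr.
have [t0|t0] := leP t 0; first by rewrite mulr0 mul0r.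
move: tM; rewrite ltr_pdivlMr ?mulr_gt0 // -natr1.
by move: (ler0n R s) M0; nra.
Qed.

(* far_point t e fails for small t by compactness; by holds_const_near0 it then
   fails for all t < e ^+ N. *)
Lemma lojasiewicz : exists p : nat, forall e x, 0 < e <= 2^-1 ->
  (forall i, - r <= x i <= r) -> (forall j, - e ^+ p <= (g j).@[x]) ->
  exists2 y, nonneg_set g y & forall i, `|x i - y i| <= e.
Proof.
have [N [e0 e00 const]] := holds_const_near0 _ (rformula_far g r).
pose e1 := Num.min (2^-1) (e0 / 2).
have e10 : 0 < e1 by rewrite lt_min invr_gt0 ltr0n divr_gt0.
have e1e0 : e1 < e0 by rewrite gt_min; apply/orP; right; lra.
(* [holds_const_near0] would carry a far point at [t] down to an arbitrarily small parameter, where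
   [not_far_point] excludes it. *)
have nfar e t : 0 < e < e0 -> 0 < t < e ^+ N -> ~ far_point g r t e.
  move=> /andP[e_gt0 ee0] /andP[t0 tN] far.
  have [t1 t10 /(_ (Num.min (t1 / 2) t))] := not_far_point _ e_gt0; apply.
    by rewrite gt_min; apply/orP; left; lra.
  apply/(holds_far g r _ _ (ltW e_gt0)); apply: (const e t) => //.
  - by rewrite e_gt0.
  - by rewrite t0.
  - by rewrite lt_min t0 divr_gt0 //= gt_min tN orbT.
  - exact/(holds_far g r _ _ (ltW e_gt0)).
(* The germ argument says nothing for e between [e1] and 1/2. There e^q <= 2^-q < e1^N, so a far
   point for e would be one for [e1], which is excluded. For e < [e1] the exponent N+1 gives the
   strict inequality with e^N. *)
have [q qP] : exists q : nat, (2^-1 : R) ^+ q < e1 ^+ N.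
  pose q := Num.bound (e1 ^+ N)^-1; exists q.
  have eN0 : 0 < e1 ^+ N by rewrite exprn_gt0.
  rewrite exprVn invf_plt ?posrE ?exprn_gt0 //.
  apply: (@lt_le_trans _ _ q%:R).
    by apply: archi_boundP; rewrite invr_ge0 ltW.
  by rewrite -natrX ler_nat ltnW // ltn_expl.
exists (q + N.+1)%N => e x /andP[e_gt0 e2] hr hg.
have close_or y : (exists i, e <= `|x i - y i|) \/ forall i, `|x i - y i| <= e.
  case: (pselect (exists i, e <= `|x i - y i|)) => [|no]; [by left | right => i].
  by case: (leP `|x i - y i| e) => // /ltW h; case: no; exists i.
case: (pselect (exists2 y, nonneg_set g y & forall i, `|x i - y i| <= e)) => // no.
exfalso.
have far t e' : e ^+ (q + N.+1) <= t -> e' <= e -> far_point g r t e'.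
  move=> ht he'; exists x; split=> // [j|y Sy].
    by apply: le_trans (hg j); rewrite lerN2.
  have [[i hi]|close] := close_or y; first by exists i; exact: le_trans hi.
  by case: no; exists y.
have e_lt1 : e < 1 by lra.
have eX0 k : 0 < e ^+ k by rewrite exprn_gt0.
have [ee1|ee1] := ltP e e1.
  apply: (nfar e (e ^+ (q + N.+1))); last by apply: far.
    by rewrite e_gt0 (lt_trans ee1).
  by rewrite eX0 ltr_iXn2l // addnS ltnS leq_addl.
apply: (nfar e1 (e ^+ (q + N.+1))); last by apply: far.
  by rewrite e10.
rewrite eX0 /=; apply: le_lt_trans qP.
apply: (@le_trans _ _ (e ^+ q)); first by rewrite ler_wiXn2l ?ltW ?leq_addr.
by apply: lerXn2r => //; rewrite nnegrE ?invr_ge0 ?ler0n ?(ltW e_gt0).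
Qed.

End LojasiewiczInequality.

(** * The coefficient norm *)

Section ProductBounds.
Context {R : realDomainType}.

Lemma norm_prod_le (I : Type) (l : seq I) (F : I -> R) (k : I -> nat) (r : R) :
  (forall i, `|F i| <= r ^+ k i) -> `|\prod_(i <- l) F i| <= r ^+ (\sum_(i <- l) k i).
Proof.
move=> Fr; elim: l => [|i l IHl]; first by rewrite !big_nil normr1.
by rewrite !big_cons normrM exprD ler_pM.
Qed.

(** Factors are exchanged one at a time. The weights [k i] let factors of different degrees be
    compared, so that monomials are covered. *)
Lemma prod_diff_le (I : Type) (l : seq I) (F G : I -> R) (k : I -> nat) (r delta : R) :
  0 <= r -> 0 <= delta ->
  (forall i, `|F i| <= r ^+ k i) -> (forall i, `|G i| <= r ^+ k i) ->
  (forall i, `|F i - G i| <= (k i)%:R * delta * r ^+ k i) ->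
  `|\prod_(i <- l) F i - \prod_(i <- l) G i|
    <= (\sum_(i <- l) k i)%:R * delta * r ^+ (\sum_(i <- l) k i).
Proof.
move=> r0 delta0 Fr Gr FG; elim: l => [|i l IHl].
  by rewrite !big_nil subrr normr0 !mul0r.
rewrite !big_cons natrD exprD; set F' := \prod_(j <- l) F j in IHl *.
set G' := \prod_(j <- l) G j in IHl *; set K := (\sum_(j <- l) k j)%N in IHl *.
have -> : F i * F' - G i * G' = F i * (F' - G') + (F i - G i) * G' by ring.
have -> : ((k i)%:R + K%:R) * delta * (r ^+ k i * r ^+ K) =
   r ^+ k i * (K%:R * delta * r ^+ K) + (k i)%:R * delta * r ^+ k i * r ^+ K by ring.
rewrite (le_trans (ler_normD _ _)) // !normrM lerD // ler_pM //.
exact: norm_prod_le.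
Qed.

Lemma power_diff_le (a b r e : R) (k : nat) : 1 <= r -> 0 <= e ->
  `|a| <= r -> `|b| <= r -> `|a - b| <= e ->
  `|a ^+ k - b ^+ k| <= k%:R * e * r ^+ k.
Proof.
move=> r1 e0 ar br ab.
have h := @prod_diff_le _ (iota 0 k) (fun=> a) (fun=> b) (fun=> 1%N) r e.
have sum1 : (\sum_(i <- iota 0 k) 1)%N = k by rewrite sum1_size size_iota.
have prodE (c : R) : \prod_(i <- iota 0 k) c = c ^+ k.
  by rewrite big_const_seq count_predT size_iota -Monoid.iteropE.
move: h; rewrite sum1 !prodE; apply=> //.
- exact: le_trans r1.
- by move=> _; rewrite mul1r expr1 (le_trans ab) // ler_peMr.
Qed.

End ProductBounds.

(** * The sum of the absolute values of the coefficients *)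

Section L1Norm.
Context {R : realType} {n : nat}.
Implicit Types (p q : {mpoly R[n]}) (m : 'X_{1..n}) (x y : 'I_n -> R).

(** This norm is submultiplicative and controls values and Lipschitz constants; [l1norm_horner_le]
    links it to [bullet_norm]. *)
Definition l1norm p : R := \sum_(m <- msupp p) `|p@_m|.

Lemma l1norm_ge0 p : 0 <= l1norm p.
Proof. exact: sumr_ge0. Qed.

Lemma l1normwE k p : (msize p <= k)%N ->
  l1norm p = \sum_(m : 'X_{1..n < k}) `|p@_m|.
Proof.
move=> pk; rewrite /l1norm (big_mksub 'X_{1..n < k}) /=; first last.
- by move=> m /msize_mdeg_lt /leq_trans; apply.
- exact: msupp_uniq.
by rewrite big_rmcond //= => m /memN_msupp_eq0 ->; rewrite normr0.
Qed.

Lemma l1normD p q : l1norm (p + q) <= l1norm p + l1norm q.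
Proof.
have leM := msizeD_le p q; have lep := leq_maxl (msize p) (msize q).
have leq := leq_maxr (msize p) (msize q).
rewrite (l1normwE _ _ leM) (l1normwE _ _ lep) (l1normwE _ _ leq) -big_split.
by apply: ler_sum => m _; rewrite mcoeffD ler_normD.
Qed.

Lemma l1norm0 : l1norm 0 = 0.
Proof. by rewrite /l1norm msupp0 big_nil. Qed.

Lemma l1norm_sum (I : Type) (r : seq I) (P : pred I) (F : I -> {mpoly R[n]}) :
  l1norm (\sum_(i <- r | P i) F i) <= \sum_(i <- r | P i) l1norm (F i).
Proof.
elim/big_rec2: _ => [|i y1 y2 _ h]; first by rewrite l1norm0.
by rewrite (le_trans (l1normD _ _)) // lerD2l.
Qed.

Lemma l1normZ (c : R) p : l1norm (c *: p) = `|c| * l1norm p.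
Proof.
rewrite (l1normwE _ _ (msizeZ_le p c)) (l1normwE _ _ (leqnn (msize p))) mulr_sumr.
by apply: eq_bigr => m _; rewrite mcoeffZ normrM.
Qed.

Lemma l1normN p : l1norm (- p) = l1norm p.
Proof. by rewrite -scaleN1r l1normZ normrN1 mul1r. Qed.

Lemma l1normX m : l1norm 'X_[m] = 1.
Proof. by rewrite /l1norm msuppX big_seq1 mcoeffX eqxx normr1. Qed.

Lemma l1normC (c : R) : l1norm c%:MP = `|c|.
Proof. by rewrite -[c%:MP]mulr1 mul_mpolyC l1normZ -mpolyX0 l1normX mulr1. Qed.

Lemma l1normM p q : l1norm (p * q) <= l1norm p * l1norm q.
Proof.
rewrite mpolyME (le_trans (l1norm_sum _ _ _ _)) // big_allpairs mulr_suml.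
apply: ler_sum => m1 _; rewrite mulr_sumr; apply: ler_sum => m2 _ /=.
by rewrite l1normZ l1normX mulr1 normrM.
Qed.

Lemma l1normXn p k : l1norm (p ^+ k) <= l1norm p ^+ k.
Proof.
elim: k => [|k IHk]; first by rewrite !expr0 -mpolyX0 l1normX.
by rewrite !exprS (le_trans (l1normM _ _)) // ler_wpM2l ?l1norm_ge0.
Qed.

(** Evaluations and Bernstein coefficients are linear forms given by their values on monomials.
    Comparing two such forms monomial by monomial yields size, Lipschitz and approximation bounds
    alike. *)
Lemma l1norm_coef_sum p (c c' : 'X_{1..n} -> R) (e : R) : 0 <= e ->
  (forall m, (mdeg m < msize p)%N -> `|c m - c' m| <= e) ->
  `|\sum_(m <- msupp p) p@_m * c m - \sum_(m <- msupp p) p@_m * c' m| <= l1norm p * e.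
Proof.
move=> e0 cc'; rewrite -sumrB (le_trans (ler_norm_sum _ _ _)) // /l1norm mulr_suml.
rewrite !big_seq; apply: ler_sum => m pm; rewrite -mulrBr normrM.
by rewrite ler_wpM2l // cc' // msize_mdeg_lt.
Qed.

Variable r : R.
Hypothesis r1 : 1 <= r.

Let r0 : 0 <= r. Proof. exact: le_trans r1. Qed.

Lemma monomial_bound x m : (forall i, `|x i| <= r) ->
  `|\prod_i x i ^+ m i| <= r ^+ mdeg m.
Proof.
move=> xr; rewrite mdegE; apply: norm_prod_le => i.
by rewrite normrX lerXn2r ?nnegrE.
Qed.

Lemma monomial_diff_le x y m (e : R) : 0 <= e ->
  (forall i, `|x i| <= r) -> (forall i, `|y i| <= r) ->
  (forall i, `|x i - y i| <= e) ->
  `|\prod_i x i ^+ m i - \prod_i y i ^+ m i| <= (mdeg m)%:R * e * r ^+ mdeg m.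
Proof.
move=> e0 xr yr xy; rewrite mdegE; apply: prod_diff_le => // i.
- by rewrite normrX lerXn2r ?nnegrE.
- by rewrite normrX lerXn2r ?nnegrE.
- exact: power_diff_le.
Qed.

Lemma meval_bound p x d : (msize p <= d.+1)%N -> (forall i, `|x i| <= r) ->
  `|p.@[x]| <= l1norm p * r ^+ d.
Proof.
move=> pd xr; rewrite mevalE.
have := l1norm_coef_sum p (fun m => \prod_i x i ^+ m i) (fun=> 0) (r ^+ d).
rewrite [X in _ - X]big1 => [|m _]; last by rewrite mulr0.
rewrite subr0; apply=> [|m mp]; first exact: exprn_ge0.
rewrite subr0 (le_trans (monomial_bound _ _ xr)) // ler_weXn2l //.
by rewrite -ltnS (leq_trans mp).
Qed.

Lemma meval_lipschitz p x y d (e : R) : (msize p <= d.+1)%N -> 0 <= e ->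
  (forall i, `|x i| <= r) -> (forall i, `|y i| <= r) ->
  (forall i, `|x i - y i| <= e) ->
  `|p.@[x] - p.@[y]| <= l1norm p * (d%:R * e * r ^+ d).
Proof.
move=> pd e0 xr yr xy; rewrite !mevalE; apply: l1norm_coef_sum => [|m mp].
  by rewrite !mulr_ge0 // exprn_ge0.
have md : (mdeg m <= d)%N by rewrite -ltnS (leq_trans mp).
rewrite (le_trans (monomial_diff_le x y m e e0 xr yr xy)) //.
by rewrite ler_pM ?mulr_ge0 ?exprn_ge0 ?ler_wpM2r ?ler_nat ?ler_weXn2l.
Qed.

End L1Norm.

(** * Bernstein coefficients on a cube *)

Lemma ffact_add (N l j : nat) : (l <= j <= N)%N ->
  (N ^_ l * (N - l) ^_ (j - l) = N ^_ j)%N.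
Proof.
move=> /andP[lj jN]; apply/eqP; rewrite -(eqn_pmul2r (fact_gt0 (N - j))).
rewrite ffact_fact // -mulnA (_ : N - j = N - l - (j - l))%N; last by lia.
by rewrite !ffact_fact //; lia.
Qed.

Lemma bin_mul_ffact (N l j : nat) : (l <= j <= N)%N ->
  ('C(N, j) * j ^_ l = N ^_ l * 'C(N - l, j - l))%N.
Proof.
move=> ljN; have /andP[lj jN] := ljN.
apply/eqP; rewrite -(eqn_pmul2r (fact_gt0 (j - l))) -!mulnA bin_ffact.
by rewrite ffact_fact // bin_ffact ffact_add.
Qed.

(** The binomial theorem for [(v + u) ^+ (N - l) = 1], multiplied by [u ^+ l]; the index shift by
    [l] turns binomials of [N - l] into falling factorials times binomials of [N]. *)
Lemma bernstein_ffact (A : comNzRingType) (N l : nat) (u v : A) :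
  (l <= N)%N -> u + v = 1 ->
  (N ^_ l)%:R * u ^+ l =
    \sum_(j < N.+1) ('C(N, j) * j ^_ l)%:R * (u ^+ j * v ^+ (N - j)).
Proof.
move=> lN uv; rewrite -(big_mkord xpredT
  (fun j => ('C(N, j) * j ^_ l)%:R * (u ^+ j * v ^+ (N - j)))).
rewrite (@big_cat_nat _ _ _ l) //=; last by rewrite leqW.
rewrite [X in _ = X + _]big_nat_cond [X in _ = X + _]big1 ?add0r; last first.
  by move=> j /andP[/andP[_ jl] _]; rewrite ffact_small // muln0 mul0r.
rewrite -{3}[l]add0n big_addn subSn // big_mkord.
have -> : u ^+ l = u ^+ l * (v + u) ^+ (N - l) by rewrite addrC uv expr1n mulr1.
rewrite exprDn !mulr_sumr; apply: eq_bigr => i _.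
rewrite bin_mul_ffact; last by rewrite leq_addl /=; have := ltn_ord i; lia.
rewrite addnK natrM -mulr_natr exprD (_ : N - l - i = N - (i + l))%N; first by ring.
by lia.
Qed.

(** * Bernstein coefficients of powers of one variable *)

Section Coefficients.
Context {R : realType}.
Variables (N : nat) (r : R).
Implicit Types (j k l : nat).

(** By [bernstein_ffact], the j-th Bernstein coefficient of degree [N] of u^l on [0, 1]. *)
Definition ffact_ratio j l : R := (j ^_ l)%:R / (N ^_ l)%:R.

Lemma ffact_ratioE j l : ffact_ratio j l = \prod_(i < l) ((j - i)%:R / (N - i)%:R).
Proof. by rewrite /ffact_ratio !ffact_prod !natr_prod prodf_div. Qed.

Lemma ffact_ratio_bound j l : (l <= N)%N -> (j <= N)%N -> 0 <= ffact_ratio j l <= 1.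
Proof.
move=> lN jN; rewrite divr_ge0 //= ler_pdivrMr ?ltr0n ?ffact_gt0 // mul1r ler_nat.
by rewrite !ffact_prod leq_prod // => i _; rewrite leq_sub2r.
Qed.

(** Factor by factor, (j - i)/(N - i) differs from j/N by at most i/N <= D/N, and all factors lie in
    [0, 1], so [prod_diff_le] applies with radius 1. *)
Lemma ffact_ratio_diff D j l : (l <= D <= N)%N -> (0 < N)%N -> (j <= N)%N ->
  `|ffact_ratio j l - (j%:R / N%:R) ^+ l| <= l%:R * (D%:R / N%:R).
Proof.
move=> /andP[lD DN] N0 jN; have N0' : 0 < N%:R :> R by rewrite ltr0n.
have sum1 : (\sum_(i < l) 1)%N = l by rewrite sum1_card card_ord.
have -> : (j%:R / N%:R) ^+ l = \prod_(i < l) (j%:R / N%:R) :> R.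
  by rewrite prodr_const card_ord.
have jN1 : 0 <= (j%:R / N%:R : R) <= 1.
  by rewrite divr_ge0 // ler_pdivrMr // mul1r ler_nat.
rewrite ffact_ratioE.
apply: (@le_trans _ _ ((\sum_(i < l) 1)%N%:R * (D%:R / N%:R) * 1 ^+ (\sum_(i < l) 1)%N));
  last by rewrite sum1 expr1n mulr1.
apply: (prod_diff_le _ _ _ _ (fun=> 1%N)) => //.
- by rewrite divr_ge0.
- move=> i; rewrite expr1n ger0_norm ?divr_ge0 //.
  have Ni : (0 < N - i)%N by have := ltn_ord i; lia.
  by rewrite ler_pdivrMr ?ltr0n // mul1r ler_nat leq_sub2r.
- by move=> i; rewrite expr1n; case/andP: jN1 => a b; rewrite ger0_norm.
move=> i; rewrite mul1r expr1n mulr1.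
have iN : (i < N)%N by have := ltn_ord i; lia.
have iD : i%:R <= D%:R :> R by rewrite ler_nat; have := ltn_ord i; lia.
case: (leqP i j) => [ij|ji]; last first.
  (* Here the natural subtraction truncates to 0, and j/N is itself below i/N. *)
  rewrite (_ : j - i = 0)%N; last by lia.
  rewrite mul0r sub0r normrN ger0_norm ?divr_ge0 // ler_pM2r ?invr_gt0 //.
  by rewrite (le_trans _ iD) // ler_nat ltnW.
have Ni : 0 < (N - i)%:R :> R by rewrite ltr0n subn_gt0.
have -> : (j - i)%:R / (N - i)%:R - j%:R / N%:R =
    - (i%:R / N%:R * ((N - j)%:R / (N - i)%:R)) :> R.
  rewrite !natrB //; last exact: ltnW.
  have hN : N%:R != 0 :> R by rewrite gt_eqF.
  have hNi : N%:R - i%:R != 0 :> R by rewrite subr_eq0 gt_eqF // ltr_nat.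
  by field; rewrite ?hN ?hNi.
rewrite normrN ger0_norm; last by apply: mulr_ge0; apply: divr_ge0.
apply: (@le_trans _ _ (i%:R / N%:R)); last by rewrite ler_pM2r ?invr_gt0.
rewrite -[leRHS]mulr1 ler_wpM2l ?divr_ge0 // ler_pdivrMr // mul1r ler_nat.
by rewrite leq_sub2l.
Qed.

(** The j-th Bernstein coefficient of x^k on [-r, r], from the binomial expansion of (-r + 2ru)^k.
    In the same coordinate, [node] is the point u = j/N. *)
Definition bcoef j k : R :=
  \sum_(l < k.+1) (- r) ^+ (k - l) * (2 * r) ^+ l *+ 'C(k, l) * ffact_ratio j l.

Definition node j : R := - r + 2 * r * (j%:R / N%:R).

Hypothesis r0 : 0 <= r.

(** The source of the constant 3r: the absolute values of -r and 2r are added. *)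
Let binomial3 k : \sum_(l < k.+1) r ^+ (k - l) * (2 * r) ^+ l *+ 'C(k, l) = (3 * r) ^+ k.
Proof. by rewrite -exprDn; congr (_ ^+ _); ring. Qed.

Let term_norm k l : `|(- r) ^+ (k - l) * (2 * r) ^+ l *+ 'C(k, l)| =
  r ^+ (k - l) * (2 * r) ^+ l *+ 'C(k, l).
Proof.
rewrite normrMn normrM !normrX normrN (ger0_norm r0).
by rewrite ger0_norm // mulr_ge0.
Qed.

Lemma bcoef_bound j k : (k <= N)%N -> (j <= N)%N -> `|bcoef j k| <= (3 * r) ^+ k.
Proof.
move=> kN jN; rewrite -binomial3 (le_trans (ler_norm_sum _ _ _)) //.
apply: ler_sum => l _; rewrite normrM term_norm ler_piMr //.
  by rewrite mulrn_wge0 // mulr_ge0 // exprn_ge0 // mulr_ge0.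
have lN : (l <= N)%N by have := ltn_ord l; lia.
by have /andP[h0 h1] := ffact_ratio_bound j l lN jN; rewrite ger0_norm.
Qed.

Lemma bcoef_diff D j k : (k <= D <= N)%N -> (0 < N)%N -> (j <= N)%N ->
  `|bcoef j k - node j ^+ k| <= k%:R * (D%:R / N%:R) * (3 * r) ^+ k.
Proof.
move=> /andP[kD DN] N0 jN.
rewrite exprDn /bcoef -sumrB -binomial3 mulr_sumr (le_trans (ler_norm_sum _ _ _)) //.
apply: ler_sum => l _.
have -> : (- r) ^+ (k - l) * (2 * r * (j%:R / N%:R)) ^+ l *+ 'C(k, l) =
   (- r) ^+ (k - l) * (2 * r) ^+ l *+ 'C(k, l) * (j%:R / N%:R) ^+ l.
  by rewrite [in LHS]exprMn [in LHS]mulrA [in RHS]mulrnAl.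
rewrite -mulrBr normrM term_norm [leRHS]mulrC ler_wpM2l //.
  by rewrite mulrn_wge0 // mulr_ge0 // exprn_ge0 // mulr_ge0.
have lk : (l <= k)%N by have := ltn_ord l; lia.
rewrite (le_trans (ffact_ratio_diff D j l _ N0 jN)) //.
  by rewrite (leq_trans lk kD).
by rewrite ler_wpM2r ?divr_ge0 // ler_nat.
Qed.

Lemma node_bound j : (0 < N)%N -> (j <= N)%N -> - r <= node j <= r.
Proof.
move=> N0 jN; have N0' : 0 < N%:R :> R by rewrite ltr0n.
have h0 : 0 <= (j%:R / N%:R : R) by rewrite divr_ge0.
have h1 : (j%:R / N%:R : R) <= 1 by rewrite ler_pdivrMr // mul1r ler_nat.
rewrite /node; move: h0 h1; set q := _ / _ => h0 h1.
have rq0 : 0 <= r * q by rewrite mulr_ge0.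
have rq1 : 0 <= r * (1 - q) by rewrite mulr_ge0 // subr_ge0.
apply/andP; split; lra.
Qed.

End Coefficients.

Section MPolyDegrees.
Context {R : realType} {n : nat}.
Implicit Types (p q : {mpoly R[n]}).

Lemma msizeM_leq p q a b : (msize p <= a.+1)%N -> (msize q <= b.+1)%N ->
  (msize (p * q) <= (a + b).+1)%N.
Proof.
case: (eqVneq p 0) => [->|p0]; first by rewrite mul0r msize0.
case: (eqVneq q 0) => [->|q0]; first by rewrite mulr0 msize0.
move=> pa qb; rewrite msizeM // -subn1 leq_subLR add1n -addSn -addnS; exact: leq_add.
Qed.

Lemma msizeD_leq p q k : (msize p <= k)%N -> (msize q <= k)%N ->
  (msize (p + q) <= k)%N.
Proof. by move=> pk qk; rewrite (leq_trans (msizeD_le _ _)) // geq_max pk. Qed.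

Lemma msize_sum_leq (I : Type) (r : seq I) (P : pred I) (F : I -> {mpoly R[n]}) k :
  (forall i, P i -> (msize (F i) <= k)%N) -> (msize (\sum_(i <- r | P i) F i) <= k)%N.
Proof.
move=> Fk; elim/big_ind: _ => // [|p q]; first by rewrite msize0.
exact: msizeD_leq.
Qed.

Lemma msizeXn_leq p a k : (msize p <= a.+1)%N -> (msize (p ^+ k) <= (k * a).+1)%N.
Proof.
move=> pa; elim: k => [|k IHk]; first by rewrite expr0 msize1.
by rewrite exprS mulSn; exact: msizeM_leq.
Qed.

Lemma msizeX_leq i : (msize ('X_i : {mpoly R[n]}) <= 2)%N.
Proof. by rewrite msizeX mdeg1. Qed.

Lemma msizeC_leq (c : R) k : (msize (c%:MP : {mpoly R[n]}) <= k.+1)%N.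
Proof. by rewrite msizeC; case: (c != 0). Qed.

Lemma sos_mpolyC (c : R) : 0 <= c -> sum_of_squares (c%:MP : {mpoly R[n]}).
Proof. by move=> /sos_ge0; exact: (sos_rmorph _ (mpolyC n (R := R))). Qed.

Lemma sosZ (c : R) p : 0 <= c -> sum_of_squares p -> sum_of_squares (c *: p).
Proof. by move=> c0 sp; rewrite -mul_mpolyC; apply: sosM => //; exact: sos_mpolyC. Qed.

Lemma sum_msupp_wide p k (c : 'X_{1..n} -> R) : (msize p <= k)%N ->
  \sum_(m <- msupp p) p@_m * c m = \sum_(m : 'X_{1..n < k}) p@_m * c m.
Proof.
move=> pk; rewrite (big_mksub 'X_{1..n < k}) /=; first last.
- by move=> m /msize_mdeg_lt /leq_trans; apply.
- exact: msupp_uniq.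
by rewrite big_rmcond //= => m /memN_msupp_eq0 ->; rewrite mul0r.
Qed.

End MPolyDegrees.

(** * Products in the quadratic module generated by one element, with degrees *)

Section Ball.
Context {R : realType} {n : nat}.
Variable b : {mpoly R[n]}.
Hypothesis b_deg : (msize b <= 3)%N.

(* As b ^+ 2 is a square, the quadratic module generated by b alone is closed
   under products. For k = 0 the truncated bound 2 * k - 1 forces t = 0. *)
Definition ball_cert (k : nat) (q : {mpoly R[n]}) := exists s t : {mpoly R[n]},
  [/\ sum_of_squares s, sum_of_squares t, q = s + t * b,
      (msize s <= (2 * k).+1)%N & (msize t <= 2 * k - 1)%N].

(** In (s + tb)(s' + t'b) the term tt'b^2 joins the free part, and st' + ts' multiplies b. Zero
    multipliers are treated apart, since a nonzero [t] forces [k] to be positive and makes the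
    truncated bound exact. *)
Lemma ball_certM k k' q q' : ball_cert k q -> ball_cert k' q' ->
  ball_cert (k + k') (q * q').
Proof.
move=> [s [t [ss st -> sk tk]]] [s' [t' [ss' st' -> sk' tk']]].
exists (s * s' + t * t' * b ^+ 2), (s * t' + t * s'); split.
- by apply: sosD; apply: sosM => //; [exact: sosM | exact: sos_sqr].
- by apply: sosD; exact: sosM.
- by ring.
- apply: msizeD_leq; first by have := msizeM_leq s s' (2 * k) (2 * k') sk sk'; lia.
  case: (eqVneq t 0) tk => [->|t0 tk]; first by rewrite !mul0r msize0.
  case: (eqVneq t' 0) tk' => [->|t'0 tk']; first by rewrite mulr0 mul0r msize0.
  case: (eqVneq b 0) b_deg => [->|b0 bdeg]; first by rewrite expr0n mulr0 msize0.
  rewrite -msize_poly_eq0 in t0; rewrite -msize_poly_eq0 in t'0.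
  have tt' := @msizeM_leq _ _ t t' (2 * k - 2) (2 * k' - 2) _ _.
  have bb := @msizeXn_leq _ _ b 2 2 bdeg.
  have := @msizeM_leq _ _ (t * t') (b ^+ 2) (2 * k - 2 + (2 * k' - 2)) (2 * 2).
  lia.
- apply: msizeD_leq.
    case: (eqVneq t' 0) tk' => [->|t'0 tk']; first by rewrite mulr0 msize0.
    rewrite -msize_poly_eq0 in t'0.
    have := @msizeM_leq _ _ s t' (2 * k) (2 * k' - 2); lia.
  case: (eqVneq t 0) tk => [->|t0 tk]; first by rewrite mul0r msize0.
  rewrite -msize_poly_eq0 in t0.
  have := @msizeM_leq _ _ t s' (2 * k - 2) (2 * k'); lia.
Qed.

Lemma ball_certZ (c : R) k q : 0 <= c -> ball_cert k q -> ball_cert k (c *: q).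
Proof.
move=> c0 [s [t [ss st -> sk tk]]]; exists (c *: s), (c *: t); split.
- exact: sosZ.
- exact: sosZ.
- by rewrite scalerDr scalerAl.
- exact: leq_trans (msizeZ_le _ _) _.
- exact: leq_trans (msizeZ_le _ _) _.
Qed.

Lemma ball_cert1 : ball_cert 0 1.
Proof.
exists 1, 0; split=> //; [exact: sos1 | exact: sos0 | | |].
- by rewrite mul0r addr0.
- by rewrite msize1.
- by rewrite msize0.
Qed.

Lemma ball_certXn k q a : ball_cert k q -> ball_cert (a * k) (q ^+ a).
Proof.
move=> cq; elim: a => [|a IHa]; first by rewrite expr0 mul0n; exact: ball_cert1.
by rewrite exprS mulSn; exact: ball_certM.
Qed.

Lemma ball_cert_prod (I : Type) (l : seq I) (F : I -> {mpoly R[n]}) k :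
  (forall i, ball_cert k (F i)) -> ball_cert (size l * k) (\prod_(i <- l) F i).
Proof.
move=> cF; elim: l => [|i l IHl]; first by rewrite big_nil; exact: ball_cert1.
by rewrite big_cons mulSn; exact: ball_certM.
Qed.

End Ball.

(** * Bernstein expansion on the cube [-r, r]^n *)

Section Bernstein.
Context {R : realType} {n : nat}.
Variable r : R.
Hypothesis r_gt0 : 0 < r.

Definition ball_poly : {mpoly R[n]} := (r ^+ 2)%:MP - \sum_(i < n) 'X_i ^+ 2.

Lemma ball_poly_deg : (msize ball_poly <= 3)%N.
Proof.
apply: msizeD_leq; first exact: msizeC_leq.
rewrite msizeN; apply: msize_sum_leq => i _.
exact: (msizeXn_leq _ 1 2 (msizeX_leq i)).
Qed.

Definition unit_coord i : {mpoly R[n]} := (2 * r)^-1 *: (r%:MP + 'X_i).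
Definition unit_cocoord i : {mpoly R[n]} := (2 * r)^-1 *: (r%:MP - 'X_i).

Lemma unit_coordD i : unit_coord i + unit_cocoord i = 1.
Proof.
rewrite /unit_coord /unit_cocoord -scalerDr addrACA subrr addr0 -mpolyCD.
rewrite -mul_mpolyC -mpolyCM (_ : _ * _ = 1) ?mpolyC1 //.
by field; rewrite gt_eqF.
Qed.

Lemma mvar_unit_coord i : 'X_i = (- r)%:MP + (2 * r) *: unit_coord i :> {mpoly R[n]}.
Proof.
rewrite scalerA divff ?gt_eqF ?mulr_gt0 // scale1r addrA -mpolyCD addNr mpolyC0.
by rewrite add0r.
Qed.

(** The identity (r + eX_i)^2 + (sum of X_j^2 over j != i) + ball_poly = 2r(r + eX_i), for e = 1 or
    -1, exhibits each linear factor of the Bernstein basis in the module of the ball. *)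
Lemma ball_cert_linear (e : R) i : e ^+ 2 = 1 ->
  ball_cert ball_poly 1 ((2 * r)^-1 *: (r%:MP + e *: 'X_i)).
Proof.
move=> e2; apply: ball_certZ; first by rewrite invr_ge0 mulr_ge0 // ltW.
have r2 : 0 <= (2 * r)^-1 by rewrite invr_ge0 mulr_ge0 // ltW.
exists ((2 * r)^-1 *: ((r%:MP + e *: 'X_i) ^+ 2 + \sum_(j < n | j != i) 'X_j ^+ 2)),
  (2 * r)^-1%:MP; split.
- apply: sosZ => //; apply: sosD; first exact: sos_sqr.
  by apply: sos_sum => j _; exact: sos_sqr.
- exact: sos_mpolyC.
- have -> : ball_poly = (r ^+ 2)%:MP - ('X_i ^+ 2 + \sum_(j < n | j != i) 'X_j ^+ 2).
    by rewrite /ball_poly (bigD1 i).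
  rewrite mul_mpolyC -scalerDr.
  set S := \sum_(j < n | _) _; set X := 'X_i.
  have -> : (r%:MP + e *: X) ^+ 2 + S + ((r ^+ 2)%:MP - (X ^+ 2 + S)) =
      (2 * r) *: (r%:MP + e *: X).
    have e1 : e%:MP ^+ 2 = 1 :> {mpoly R[n]} by rewrite -mpolyC1 -e2 rmorphXn.
    rewrite rmorphXn -!mul_mpolyC mpolyCM /= mpolyC_nat.
    transitivity (2 * r%:MP * (r%:MP + e%:MP * X) + (e%:MP ^+ 2 - 1) * X ^+ 2).
      by ring.
    by rewrite e1 subrr mul0r addr0.
  by rewrite scalerA mulVf ?scale1r // gt_eqF // mulr_gt0.
- apply: leq_trans (msizeZ_le _ _) _; apply: msizeD_leq.
    apply: (msizeXn_leq _ 1 2); apply: msizeD_leq; first exact: msizeC_leq.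
    by apply: leq_trans (msizeZ_le _ _) (msizeX_leq _).
  by apply: msize_sum_leq => j _; exact: (msizeXn_leq _ 1 2 (msizeX_leq j)).
- exact: msizeC_leq.
Qed.

Section Expansion.
Variable N : nat.
Implicit Type phi : {ffun 'I_n -> 'I_N.+1}.

Definition bern_basis phi : {mpoly R[n]} := \prod_i ('C(N, phi i)%:R *:
  (unit_coord i ^+ phi i * unit_cocoord i ^+ (N - phi i))).

(** The coefficient at [phi] of the monomial [m]; it factors over the variables, as the basis
    does. *)
Definition bern_weight phi (m : 'X_{1..n}) : R := \prod_i bcoef N r (phi i) (m i).

Definition bern_point phi : 'I_n -> R := fun i => node N r (phi i).

Lemma ball_cert_basis phi : ball_cert ball_poly (n * N) (bern_basis phi).
Proof.
have -> : (n * N)%N = (size (index_enum 'I_n) * N)%N.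
  by rewrite -[in LHS](card_ord n) cardT enumT.
apply: (ball_cert_prod _ ball_poly_deg) => i; apply: ball_certZ; first exact: ler0n.
have NE : (phi i * 1 + (N - phi i) * 1 = N)%N.
  by rewrite !muln1 subnKC // -ltnS.
rewrite -[X in ball_cert _ X _]NE.
apply: (ball_certM _ ball_poly_deg); apply: (ball_certXn _ ball_poly_deg).
  by have := ball_cert_linear 1 i (expr1n _ _); rewrite scale1r.
by have := ball_cert_linear (- 1) i; rewrite scaleN1r sqrrN expr1n; apply.
Qed.

(** X_i = -r + 2ru is expanded by the binomial theorem, and each power of u by [bernstein_ffact]. *)
Lemma mvar_power_bernstein i k : (k <= N)%N ->
  'X_i ^+ k = \sum_(j < N.+1) bcoef N r j k *: ('C(N, j)%:R *:
    (unit_coord i ^+ j * unit_cocoord i ^+ (N - j))) :> {mpoly R[n]}.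
Proof.
move=> kN; have power l : (l <= N)%N -> unit_coord i ^+ l =
    \sum_(j < N.+1) ffact_ratio N j l *: ('C(N, j)%:R *:
      (unit_coord i ^+ j * unit_cocoord i ^+ (N - j))).
  move=> lN; have Nl0 : (N ^_ l)%:R != 0 :> R by rewrite pnatr_eq0 -lt0n ffact_gt0.
  apply: (scalerI Nl0); rewrite -mul_mpolyC mpolyC_nat.
  rewrite (bernstein_ffact _ _ _ _ _ lN (unit_coordD i)) scaler_sumr.
  apply: eq_bigr => j _; rewrite !scalerA -mul_mpolyC; congr (_ * _).
  rewrite -mpolyC_nat natrM; congr _%:MP; rewrite /ffact_ratio.
  by field.
rewrite {1}mvar_unit_coord exprDn.
under eq_bigr => l _ do rewrite exprZn power ?(leq_trans _ kN) 1?leq_ord //.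
under [RHS]eq_bigr => j _ do rewrite scaler_suml.
rewrite exchange_big; apply: eq_bigr => l _ /=.
rewrite -rmorphXn mul_mpolyC scalerA scaler_sumr -sumrMnl; apply: eq_bigr => j _.
rewrite [in LHS]scalerA scalerMnl; congr (_ *: _).
exact/esym/mulrnAl.
Qed.

Lemma monomial_bernstein m : (mdeg m <= N)%N ->
  'X_[m] = \sum_phi bern_weight phi m *: bern_basis phi :> {mpoly R[n]}.
Proof.
move=> mN; rewrite mpolyXE_id.
have miN i : (m i <= N)%N.
  by apply: leq_trans mN; rewrite mdegE (bigD1 i) //= leq_addr.
under eq_bigr => i _ do rewrite (mvar_power_bernstein i (m i) (miN i)).
rewrite bigA_distr_bigA /=; apply: eq_bigr => phi _.
by rewrite scaler_prod.
Qed.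

Variable D : nat.

(** The sum runs over all exponents of degree at most [D] rather than over the support of [p], which
    makes it visibly linear in [p]. *)
Definition bern_functional phi (p : {mpoly R[n]}) : R :=
  \sum_(m : 'X_{1..n < D.+1}) p@_m * bern_weight phi m.

Lemma bernstein_expansion p : (msize p <= D.+1)%N -> (D <= N)%N ->
  p = \sum_phi bern_functional phi p *: bern_basis phi.
Proof.
move=> pD DN; rewrite {1}(mpolywE pD).
under [RHS]eq_bigr => phi _ do rewrite scaler_suml.
rewrite exchange_big; apply: eq_bigr => m _ /=.
rewrite monomial_bernstein ?scaler_sumr; last first.
  by rewrite (leq_trans _ DN) // -ltnS bmdeg.
by apply: eq_bigr => phi _; rewrite scalerA.
Qed.

Hypothesis r_ge1 : 1 <= r.
Hypothesis N_gt0 : (0 < N)%N.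

Lemma bern_point_bound phi i : - r <= bern_point phi i <= r.
Proof. by apply: node_bound => //; [exact: ltW | rewrite -ltnS]. Qed.

(** Bernstein coefficients are within O(1/N) of the values at grid points of the cube, so a positive
    lower bound on the cube makes all of them nonnegative for large [N]. *)
Lemma bern_functional_diff phi p : (msize p <= D.+1)%N -> (D <= N)%N ->
  `|bern_functional phi p - p.@[bern_point phi]|
    <= l1norm p * (D%:R * (D%:R / N%:R) * (3 * r) ^+ D).
Proof.
move=> pD DN; rewrite /bern_functional -(sum_msupp_wide _ _ _ pD) mevalE.
have r0 := ltW r_gt0; have r30 : 0 <= 3 * r by rewrite mulr_ge0.
have DN0 : 0 <= D%:R / N%:R :> R by rewrite divr_ge0.
apply: l1norm_coef_sum => [|m mp].
  by apply: mulr_ge0; [exact: mulr_ge0 | exact: exprn_ge0].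
have mD : (mdeg m <= D)%N by rewrite -ltnS (leq_trans mp).
have miD i : (m i <= D)%N.
  by apply: leq_trans mD; rewrite mdegE (bigD1 i) //= leq_addr.
have phiN i : (phi i <= N)%N by rewrite -ltnS.
apply: (@le_trans _ _ ((mdeg m)%:R * (D%:R / N%:R) * (3 * r) ^+ mdeg m)).
  rewrite mdegE; apply: prod_diff_le => // i.
  - by apply: bcoef_bound => //; rewrite (leq_trans (miD i)).
  - rewrite normrX lerXn2r ?nnegrE // (@le_trans _ _ r) //; last by lra.
    by rewrite ler_norml; exact: bern_point_bound.
  - by apply: bcoef_diff => //; rewrite miD.
apply: ler_pM; [exact: mulr_ge0 | exact: exprn_ge0 | |].
  by rewrite ler_wpM2r // ler_nat.
by apply: ler_weXn2l => //; rewrite (le_trans r_ge1) // ler_peMl // ler1n.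
Qed.

End Expansion.
End Bernstein.

(** * Perturbation by peak functions *)

Section PeakFunction.
Context {R : realType}.
Implicit Types (u t c e : R) (k q : nat).

(** A form of Bernoulli's inequality, by (1 - u)(1 + (q+1)u) <= 1 + qu; it yields u(1 - u)^q <=
    1/q. *)
Lemma peak_bernoulli u q : 0 <= u <= 1 -> (1 - u) ^+ q * (1 + q%:R * u) <= 1.
Proof.
move=> /andP[u0 u1]; elim: q => [|q IHq]; first by rewrite expr0 !mul1r mul0r addr0.
apply: le_trans IHq; rewrite exprSr -mulrA ler_wpM2l ?exprn_ge0 ?subr_ge0 //.
have q0 : 0 <= q%:R :> R by [].
rewrite -natr1; have := mulr_ge0 q0 (sqr_ge0 u); have := sqr_ge0 u; nra.
Qed.

Lemma peak_le (c t : R) k : 0 < c -> (0 < k)%N -> `|t| <= c ->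
  (1 - c^-1 * t) ^+ (2 * k) * t <= c / (2 * k%:R).
Proof.
move=> c0 k0 tc; have k0' : 0 < 2 * k%:R :> R by rewrite mulr_gt0 ?ltr0n.
have [t0|t0] := leP t 0.
  apply: (@le_trans _ _ 0); last by rewrite divr_ge0 ?ltW.
  by rewrite mulr_ge0_le0 // exprM exprn_ge0 // sqr_ge0.
pose u := c^-1 * t; have tE : t = c * u by rewrite mulrA mulfV ?mul1r // gt_eqF.
have u01 : 0 <= u <= 1.
  rewrite /u mulr_ge0 ?invr_ge0 ?(ltW c0) ?(ltW t0) //= ler_pdivrMl // mulr1.
  by rewrite (le_trans (ler_norm _)).
have := peak_bernoulli u (2 * k) u01; rewrite -/u tE natrM.
have /andP[u0 u1] := u01.
have : 0 <= (1 - u) ^+ (2 * k) by rewrite exprn_ge0 // subr_ge0.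
set E := _ ^+ _ => E0 h; rewrite ler_pdivlMr //.
have {}h : E * u * (2 * k%:R) <= 1 by nra.
by have := ler_wpM2l (ltW c0) h; rewrite mulr1; nra.
Qed.

Lemma peak_neg (c t e : R) k : 0 < c -> 0 <= e -> t <= - e ->
  (1 - c^-1 * t) ^+ (2 * k) * t <= - e.
Proof.
move=> c0 e0 te; have t0 : t <= 0 by lra.
have h : 1 <= (1 - c^-1 * t) ^+ (2 * k).
  have : c^-1 * t <= 0 by rewrite mulr_ge0_le0 // invr_ge0 ltW.
  by move=> ct; apply: exprn_ege1; lra.
by apply: le_trans te; rewrite ler_neMl.
Qed.

End PeakFunction.

Section Perturbation.
Context {R : realType} {n s : nat}.
Variables (g : 'I_s -> {mpoly R[n]}) (r c : R) (p : nat).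
Hypothesis r_ge1 : 1 <= r.
Hypothesis c_gt0 : 0 < c.
Hypothesis S_cube : nonneg_set g `<=` [set x | forall i, -1 < x i < 1].
Hypothesis g_bound : forall x j, (forall i, - r <= x i <= r) -> `|(g j).@[x]| <= c.
Hypothesis loj : forall e x, 0 < e <= 2^-1 ->
  (forall i, - r <= x i <= r) -> (forall j, - e ^+ p <= (g j).@[x]) ->
  exists2 y, nonneg_set g y & forall i, `|x i - y i| <= e.

(** Each summand is [g j] times a square. It is small where [g j] is nonnegative and at most [g j]
    where [g j] is negative, so subtracting it costs little near S and lifts the function away from
    S. *)
Definition peak k : {mpoly R[n]} :=
  \sum_j (1 - c^-1 *: g j) ^+ (2 * k) * g j.

Lemma meval_peak k x :
  (peak k).@[x] = \sum_j (1 - c^-1 * (g j).@[x]) ^+ (2 * k) * (g j).@[x].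
Proof.
rewrite /peak raddf_sum; apply: eq_bigr => j _ /=.
by rewrite mevalM rmorphXn /= mevalB meval1 mevalZ.
Qed.

(** If x violates no constraint by more than e^p, with e = 1/(2L), a point of S lies within e and
    [phi] drops by at most 1/2. Otherwise one violated constraint contributes at least kappa r^d +
    1, which outweighs the worst value -kappa r^d of [phi]. *)
Lemma perturb_lower_bound (phi : {mpoly R[n]}) d k (kappa L lambda : R) x :
  (msize phi <= d.+1)%N -> l1norm phi <= kappa ->
  (forall y, nonneg_set g y -> 1 <= phi.@[y]) ->
  1 <= L -> kappa * (d%:R * r ^+ d) <= L ->
  (kappa * r ^+ d + 1) * (2 * L) ^+ p <= lambda ->
  2 * lambda * s%:R * c <= k%:R -> (0 < k)%N ->
  (forall i, - r <= x i <= r) ->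
  4^-1 <= (phi - lambda *: peak k).@[x].
Proof.
move=> phid phik phiS L1 Ld Ll lk k0 xr.
have kappa0 : 0 <= kappa by apply: le_trans phik; exact: l1norm_ge0.
have r0 : 0 <= r by exact: le_trans r_ge1.
have L0 : 0 < L by exact: lt_le_trans L1.
have LX0 : 0 < (2 * L) ^+ p by rewrite exprn_gt0 // mulr_gt0.
have rd0 : 0 <= r ^+ d by rewrite exprn_ge0.
have lambda0 : 0 < lambda.
  apply: lt_le_trans Ll; rewrite mulr_gt0 //.
  by rewrite ltr_wpDl // mulr_ge0.
have k0' : 0 < 2 * k%:R :> R by rewrite mulr_gt0 ?ltr0n.
rewrite mevalB mevalZ meval_peak.
have xr' i : `|x i| <= r by rewrite ler_norml.
(* The index set is free because the first case sums over all constraints, the second over all but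
   the violated one. The bound 1/4 is what [2 * lambda * s * c <= k] provides. *)
have sum_le (J : pred 'I_s) : lambda *
    \sum_(j | J j) (1 - c^-1 * (g j).@[x]) ^+ (2 * k) * (g j).@[x] <= 4^-1.
  apply: (@le_trans _ _ (lambda * (s%:R * (c / (2 * k%:R))))).
    rewrite ler_wpM2l ?(ltW lambda0) //.
    apply: (@le_trans _ _ (\sum_(j | J j) c / (2 * k%:R))).
      by apply: ler_sum => j _; apply: peak_le => //; exact: g_bound.
    rewrite sumr_const -[leLHS]mulr_natl ler_wpM2r ?divr_ge0 ?(ltW c_gt0) ?(ltW k0') //.
    by rewrite ler_nat -[leqRHS]card_ord max_card.
  rewrite !mulrA ler_pdivrMr //; lra.
pose e := (2 * L)^-1.
have e0 : 0 < e by rewrite invr_gt0 mulr_gt0.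
have e2 : e <= 2^-1 by rewrite lef_pV2 ?posrE ?mulr_gt0 //; lra.
have [all_ge|] := pselect (forall j, - e ^+ p <= (g j).@[x]).
  have [|y Sy xy] := loj e x _ xr all_ge; first by rewrite e0.
  have yr i : `|y i| <= r.
    have /andP[y1 y2] := S_cube y Sy i.
    by have := r_ge1; rewrite ler_norml => ?; apply/andP; split; lra.
  have := meval_lipschitz r r_ge1 phi x y d e phid (ltW e0) xr' yr xy.
  have : l1norm phi * (d%:R * e * r ^+ d) <= 2^-1.
    have -> : l1norm phi * (d%:R * e * r ^+ d) = l1norm phi * (d%:R * r ^+ d) * e by ring.
    rewrite /e ler_pdivrMr ?mulr_gt0 //.
    have -> : 2^-1 * (2 * L) = L by lra.
    rewrite (le_trans _ Ld) //.
    by rewrite ler_wpM2r // mulr_ge0.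
  have := phiS y Sy; have := sum_le predT; rewrite ler_norml /=.
  set A := \sum_j _; move=> h1 h2 h3 /andP[h4 _]; lra.
move=> /existsNP[j0 /negP]; rewrite -ltNge => gj0.
have := meval_bound r r_ge1 phi x d phid xr'; rewrite ler_norml => /andP[phi_low _].
have phi_low' : - (kappa * r ^+ d) <= phi.@[x].
  by apply: le_trans phi_low; rewrite lerN2 ler_wpM2r.
rewrite (bigD1 j0) //= mulrDr.
have h1 := sum_le (fun j => j != j0).
have h2 : lambda * ((1 - c^-1 * (g j0).@[x]) ^+ (2 * k) * (g j0).@[x]) <=
    - (kappa * r ^+ d + 1).
  apply: (@le_trans _ _ (lambda * (- e ^+ p))).
    rewrite ler_wpM2l ?(ltW lambda0) //.
    by apply: peak_neg => //; [rewrite exprn_ge0 // ltW | exact: ltW].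
  by rewrite mulrN lerN2 /e exprVn ler_pdivlMr.
by move: h1 h2; set A := \sum_(_ < _ | _) _; set B := _ * (g j0).@[x]; lra.
Qed.

Lemma peak_deg k dg : (forall j, (msize (g j) <= dg.+1)%N) ->
  (msize (peak k) <= ((2 * k).+1 * dg).+1)%N.
Proof.
move=> gd; apply: msize_sum_leq => j _.
have -> : ((2 * k).+1 * dg = 2 * k * dg + dg)%N by rewrite mulSn addnC.
apply: msizeM_leq => //; apply: msizeXn_leq; apply: msizeD_leq.
  by rewrite msize1.
by rewrite msizeN (leq_trans (msizeZ_le _ _)).
Qed.

Lemma peak_l1norm k (G : R) : 1 <= c -> (forall j, l1norm (g j) + 1 <= G) ->
  l1norm (peak k) <= s%:R * G ^+ (2 * k).+1.
Proof.
move=> c1 gG; rewrite (le_trans (l1norm_sum _ _ _ _)) //.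
apply: (@le_trans _ _ (\sum_(j < s) G ^+ (2 * k).+1)); last first.
  by rewrite sumr_const card_ord -[leLHS]mulr_natl.
apply: ler_sum => j _; rewrite (le_trans (l1normM _ _)) // exprSr.
have gj0 := l1norm_ge0 (g j); have gj := gG j.
apply: ler_pM; [exact: l1norm_ge0 | exact: l1norm_ge0 | | by lra].
rewrite (le_trans (l1normXn _ _)) // lerXn2r ?nnegrE ?l1norm_ge0 //; first by lra.
rewrite (le_trans (l1normD _ _)) // l1normN l1normZ -mpolyC1 l1normC normr1.
rewrite (le_trans _ gj) // addrC lerD2r ler_piMl // ger0_norm ?invr_ge0 ?(ltW c_gt0) //.
by rewrite invf_le1.
Qed.

End Perturbation.

(** * The certificate *)

Section TwoVariablePolynomials.
Context {R : realType} {n : nat}.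
Implicit Types (f : {poly {mpoly R[n]}}) (h : {poly R}) (p q : {mpoly R[n]}).

Lemma tdeg_leq f k : (forall i, f`_i != 0 -> (msize f`_i + i <= k.+1)%N) ->
  (tdeg f <= k)%N.
Proof.
move=> fk; apply/bigmax_leqP => i fi0; have := fk _ fi0.
move: fi0; rewrite -msize_poly_eq0.
by case: (msize _) => [|j] _ //=; rewrite addSn ltnS.
Qed.

Lemma tdeg_coef f k i : (tdeg f <= k)%N -> f`_i != 0 -> (msize f`_i + i <= k.+1)%N.
Proof.
move=> fk fi0; have i_lt : (i < size f)%N.
  by rewrite ltnNge; apply: contraNN fi0 => ?; rewrite nth_default.
have := leq_trans (leq_bigmax_cond (Ordinal i_lt) fi0) fk.
by move: fi0; rewrite /= -msize_poly_eq0; case: (msize _).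
Qed.

Lemma tdeg0 : tdeg (0 : {poly {mpoly R[n]}}) = 0%N.
Proof. by rewrite /tdeg size_poly0 big_ord0. Qed.

Lemma tdegD_leq f f' k : (tdeg f <= k)%N -> (tdeg f' <= k)%N -> (tdeg (f + f') <= k)%N.
Proof.
move=> fk f'k; apply: tdeg_leq => i; rewrite coefD.
case: (eqVneq f`_i 0) => [->|fi0]; first by rewrite add0r; exact: tdeg_coef.
case: (eqVneq f'`_i 0) => [->|f'i0]; first by rewrite addr0 => _; exact: tdeg_coef.
move=> _; rewrite (leq_trans (leq_add (msizeD_le _ _) (leqnn _))) // addn_maxl geq_max.
by rewrite !tdeg_coef.
Qed.

Lemma meval_horner f x y : (f.[y%:MP]).@[x] = evalXY x y f.
Proof.
rewrite /evalXY /specX -[y in RHS](mevalC x) horner_map.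
by [].
Qed.

Lemma mcoeff_horner f k y m : (size f <= k)%N ->
  (f.[y%:MP])@_m = \sum_(i < k) (f`_i)@_m * y ^+ i.
Proof.
move=> fk; rewrite (horner_coef_wide _ fk) raddf_sum; apply: eq_bigr => i _ /=.
by rewrite -rmorphXn mulrC /= mcoeffCM mulrC.
Qed.

Lemma msize_horner_leq f k y : (forall i, (msize f`_i <= k)%N) ->
  (msize f.[y%:MP] <= k)%N.
Proof.
move=> fk; rewrite horner_coef; apply: msize_sum_leq => i _.
rewrite -rmorphXn mulrC /= mul_mpolyC; exact: leq_trans (msizeZ_le _ _) _.
Qed.

(* Locked because unification otherwise unfolds it when comparing two products. *)
Definition tensor h q : {poly {mpoly R[n]}} :=
  locked (map_poly (mpolyC n (R := R)) h * q%:P).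

Lemma tensorE h q : tensor h q = map_poly (mpolyC n (R := R)) h * q%:P.
Proof. by rewrite /tensor -lock. Qed.

Lemma coef_tensor h q i : (tensor h q)`_i = h`_i *: q.
Proof. by rewrite tensorE coefMC coef_map mul_mpolyC. Qed.

Lemma horner_tensor h q y : (tensor h q).[y%:MP] = h.[y] *: q.
Proof. by rewrite tensorE hornerM hornerC horner_map mul_mpolyC. Qed.

Lemma tensorD h p q : tensor h (p + q) = tensor h p + tensor h q.
Proof. by rewrite !tensorE polyCD mulrDr. Qed.

Lemma tensor_sumr (I : finType) (P : pred I) h (F : I -> {mpoly R[n]}) :
  tensor h (\sum_(i | P i) F i) = \sum_(i | P i) tensor h (F i).
Proof.
rewrite tensorE rmorph_sum mulr_sumr; apply: eq_bigr => i _.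
by rewrite tensorE.
Qed.

Lemma tensorM h p q : tensor h (p * q) = tensor h p * q%:P.
Proof. by rewrite !tensorE polyCM mulrA. Qed.

Lemma sos_tensor h q : sum_of_squares h -> sum_of_squares q ->
  sum_of_squares (tensor h q).
Proof.
move=> sh sq; rewrite tensorE; apply: sosM; first exact: (sos_rmorph _ (map_poly (mpolyC n (R := R)))).
exact: (sos_rmorph _ (@polyC _)).
Qed.

Lemma tdeg_tensor h q m a : (size h <= m.+1)%N -> (msize q <= a.+1)%N ->
  (tdeg (tensor h q) <= m + a)%N.
Proof.
move=> hm qa; apply: tdeg_leq => k; rewrite coef_tensor => nz.
have km : (k <= m)%N.
  rewrite leqNgt; apply: contraNN nz => mk.
  by rewrite nth_default ?scale0r // (leq_trans hm).
by rewrite addnC -addnS leq_add // (leq_trans (msizeZ_le _ _)).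
Qed.

Lemma tdeg_sum_tensor (I : finType) (h : I -> {poly R}) (q : I -> {mpoly R[n]}) m a :
  (forall i, size (h i) <= m.+1)%N -> (forall i, msize (q i) <= a.+1)%N ->
  (tdeg (\sum_i tensor (h i) (q i)) <= m + a)%N.
Proof.
move=> hm qa; elim/big_ind: _ => [|f f'|i _]; first by rewrite tdeg0.
  exact: tdegD_leq.
exact: tdeg_tensor.
Qed.

End TwoVariablePolynomials.

(** * Bernstein coefficients as polynomials in the parameter Y *)

Section BernsteinInY.
Context {R : realType} {n : nat}.
Variables (N : nat) (r : R) (D : nat).
Implicit Types (f : {poly {mpoly R[n]}}) (phi : {ffun 'I_n -> 'I_N.+1}).

Definition bern_coefY phi f : {poly R} := map_poly (bern_functional r N D phi) f.

Lemma bern_functional0 phi : bern_functional r N D phi 0 = 0.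
Proof. by rewrite /bern_functional big1 // => m _; rewrite mcoeff0 mul0r. Qed.

(** Linearity lets the functional commute with specialization of Y, so the sign of a coefficient can
    be examined for each y separately. *)
Lemma horner_bern_coefY phi f y :
  (bern_coefY phi f).[y] = bern_functional r N D phi f.[y%:MP].
Proof.
have szf : (size (bern_coefY phi f) <= size f)%N by exact: size_poly.
rewrite (horner_coef_wide _ szf) /bern_functional.
under [RHS]eq_bigr => m _ do rewrite (mcoeff_horner _ _ _ _ (leqnn _)) mulr_suml.
rewrite exchange_big; apply: eq_bigr => i _ /=.
rewrite coef_map_id0 ?bern_functional0 // mulr_suml.
by apply: eq_bigr => m _; rewrite mulrAC.
Qed.

Lemma bernstein_expansionY f : 0 < r -> (forall i, msize f`_i <= D.+1)%N ->
  (D <= N)%N -> f = \sum_phi tensor (bern_coefY phi f) (bern_basis r N phi).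
Proof.
move=> r0 fD DN; apply/polyP => i; rewrite coef_sum.
under eq_bigr => phi _ do
  rewrite coef_tensor coef_map_id0 ?bern_functional0 //.
exact: bernstein_expansion.
Qed.

End BernsteinInY.

Section Certificate.
Context {R : realType} {n s : nat}.
Variables (g : 'I_s -> {mpoly R[n]}) (r c : R) (p a dg : nat) (G : R).
Variables (tau0 : {mpoly R[n]}) (tau : 'I_s -> {mpoly R[n]}).
Hypothesis r_ge1 : 1 <= r.
Hypothesis c_ge1 : 1 <= c.
Hypothesis S_cube : nonneg_set g `<=` [set x | forall i, -1 < x i < 1].
Hypothesis g_bound : forall x j, (forall i, - r <= x i <= r) -> `|(g j).@[x]| <= c.
Hypothesis loj : forall e x, 0 < e <= 2^-1 ->
  (forall i, - r <= x i <= r) -> (forall j, - e ^+ p <= (g j).@[x]) ->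
  exists2 y, nonneg_set g y & forall i, `|x i - y i| <= e.
Hypothesis g_deg : forall j, (msize (g j) <= dg.+1)%N.
Hypothesis g_l1 : forall j, l1norm (g j) + 1 <= G.
Hypothesis tau0_sos : sum_of_squares tau0.
Hypothesis tau_sos : forall j, sum_of_squares (tau j).
Hypothesis ballE : ball_poly r = tau0 + \sum_j tau j * g j.
Hypothesis tau0_deg : (msize tau0 <= a.+1)%N.
Hypothesis tau_deg : forall j, (msize (tau j) <= a.+1)%N.

(** For every y the perturbed polynomial has nonnegative Bernstein coefficients; as polynomials in Y
    these are sums of squares. They multiply basis elements, which lie in the module of the ball and
    hence, by [ballE], in that of the [g j]. *)
Lemma certificate (f : {poly {mpoly R[n]}}) (w : {poly R}) (m d k D N : nat)
    (mu kappa L lambda : R) :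
  (forall i, msize f`_i <= d.+1)%N -> (size f <= m.+1)%N -> (size w <= m.+1)%N ->
  0 < mu -> sum_of_squares w -> (forall y, 0 < w.[y]) ->
  (forall y, l1norm f.[y%:MP] <= kappa * (mu * w.[y])) ->
  (forall x y, nonneg_set g x -> mu * w.[y] <= evalXY x y f) ->
  1 <= L -> kappa * (d%:R * r ^+ d) <= L ->
  (kappa * r ^+ d + 1) * (2 * L) ^+ p <= lambda ->
  2 * lambda * s%:R * c <= k%:R -> (0 < k)%N ->
  (d <= D)%N -> ((2 * k).+1 * dg <= D)%N -> (D <= N)%N -> (0 < N)%N ->
  (kappa + lambda * (s%:R * G ^+ (2 * k).+1)) * (D%:R ^+ 2 * (3 * r) ^+ D) * 4 <= N%:R ->
  exists (sigma0 : {poly {mpoly R[n]}}) (sigma : 'I_s -> {poly {mpoly R[n]}}),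
    [/\ sum_of_squares sigma0,
        (forall j, sum_of_squares (sigma j)),
        f = sigma0 + \sum_(j < s) sigma j * (g j)%:P,
        (tdeg sigma0 <= m + (2 * (n * N) + N + a + dg))%N
      & forall j, (tdeg (sigma j * (g j)%:P)%R <= m + (2 * (n * N) + N + a + dg))%N].
Proof.
move=> fd fm wm mu0 w_sos w0 f_l1 f_low L1 Ld Ll lk k0 dD kD DN N0 HN.
have r0 : 0 < r by exact: lt_le_trans r_ge1.
have c0 : 0 < c by exact: lt_le_trans c_ge1.
have muw y : 0 < mu * w.[y] by exact: mulr_gt0.
(* Division by [mu * w.[y]] makes f(., y) at least 1 on S and its coefficient norm at most [kappa],
   uniformly in y. *)
pose phi y := (mu * w.[y])^-1 *: f.[y%:MP].
have phi_deg y : (msize (phi y) <= d.+1)%N.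
  by apply: leq_trans (msizeZ_le _ _) _; exact: msize_horner_leq.
have phi_l1 y : l1norm (phi y) <= kappa.
  rewrite l1normZ gtr0_norm ?invr_gt0 // ler_pdivrMl // mulrC; exact: f_l1.
have phi_low y x : nonneg_set g x -> 1 <= (phi y).@[x].
  by move=> Sx; rewrite mevalZ meval_horner ler_pdivlMl // mulr1; exact: f_low.
have kappa0 : 0 <= kappa by apply: le_trans (phi_l1 0); exact: l1norm_ge0.
have lambda0 : 0 <= lambda.
  apply: le_trans Ll; rewrite mulr_ge0 ?exprn_ge0 ?mulr_ge0 ?(le_trans _ L1) //.
  by rewrite addr_ge0 // mulr_ge0 // exprn_ge0 // ltW.
pose w' := (mu * lambda) *: w.
pose H := f - tensor w' (peak g c k).
have HE y : H.[y%:MP] = (mu * w.[y]) *: (phi y - lambda *: peak g c k).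
  rewrite hornerD hornerN horner_tensor hornerZ scalerBr !scalerA mulfV ?gt_eqF //.
  by rewrite scale1r mulrAC.
have H_deg i : (msize H`_i <= D.+1)%N.
  rewrite coefB; apply: msizeD_leq; first by rewrite (leq_trans (fd i)).
  rewrite msizeN coef_tensor (leq_trans (msizeZ_le _ _)) //.
  by rewrite (leq_trans (peak_deg _ _ _ _ g_deg)).
have H_size : (size H <= m.+1)%N.
  apply/leq_sizeP => i mi; rewrite coefB coef_tensor !nth_default ?scale0r ?subr0 //.
    by apply: leq_trans mi; apply: leq_trans wm; exact: size_scale_leq.
  by rewrite (leq_trans fm).
have pert_l1 y : l1norm (phi y - lambda *: peak g c k) <=
    kappa + lambda * (s%:R * G ^+ (2 * k).+1).
  rewrite (le_trans (l1normD _ _)) // l1normN l1normZ (ger0_norm lambda0).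
  by rewrite lerD // ler_wpM2l // peak_l1norm.
have pert_deg y : (msize (phi y - lambda *: peak g c k) <= D.+1)%N.
  apply: msizeD_leq; first by rewrite (leq_trans (phi_deg y)).
  rewrite msizeN (leq_trans (msizeZ_le _ _)) //.
  by rewrite (leq_trans (peak_deg _ _ _ _ g_deg)).
pose h (v : {ffun 'I_n -> 'I_N.+1}) := bern_coefY N r D v H.
have h_sos v : sum_of_squares (h v).
  apply: nonneg_poly_sos => y; rewrite horner_bern_coefY HE.
  have -> : bern_functional r N D v ((mu * w.[y]) *: (phi y - lambda *: peak g c k)) =
      (mu * w.[y]) * bern_functional r N D v (phi y - lambda *: peak g c k).
    rewrite mulr_sumr; apply: eq_bigr => mm _; by rewrite mcoeffZ mulrA.
  rewrite mulr_ge0 ?(ltW (muw y)) //.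
  have low := perturb_lower_bound g r c p r_ge1 c0 S_cube g_bound loj (phi y) d k kappa L
    lambda (bern_point r N v) (phi_deg y) (phi_l1 y) (phi_low y) L1 Ld Ll lk k0
    (bern_point_bound r r0 N N0 v).
  have := bern_functional_diff r r0 N D r_ge1 N0 v _ (pert_deg y) DN.
  (* The factor 4 in the condition on [N] keeps the Bernstein error within the lower bound 1/4. *)
  set E := l1norm _ * _; have : E <= 4^-1.
    pose X := D%:R ^+ 2 * (3 * r) ^+ D : R.
    have X0 : 0 <= X by rewrite mulr_ge0 ?exprn_ge0 // mulr_ge0 // ltW.
    have -> : E = l1norm (phi y - lambda *: peak g c k) * X / N%:R.
      by rewrite /E /X; field; rewrite pnatr_eq0 -lt0n.
    rewrite ler_pdivrMr ?ltr0n //.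
    by have := ler_wpM2r X0 (pert_l1 y); move: HN; rewrite -/X; lra.
  by rewrite ler_norml => E4 /andP[h1 _]; lra.
have h_size v : (size (h v) <= m.+1)%N by exact: leq_trans (size_poly _ _) H_size.
have /boolp.choice[st stP] (v : {ffun 'I_n -> 'I_N.+1}) :
    exists st : {mpoly R[n]} * {mpoly R[n]},
    [/\ sum_of_squares st.1, sum_of_squares st.2,
      bern_basis r N v = st.1 + st.2 * ball_poly r,
      (msize st.1 <= (2 * (n * N)).+1)%N & (msize st.2 <= 2 * (n * N) - 1)%N].
  have [s0 [t0 [ss st bE sd td]]] := ball_cert_basis r r0 N v.
  by exists (s0, t0).
pose peak_factor j : {mpoly R[n]} := (1 - c^-1 *: g j) ^+ (2 * k).
(* With each basis element written as s + t * ball_poly, [ballE] sends s + t * tau0 to the free term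
   and t * tau j to the j-th multiplier; the latter also takes back the subtracted peak term. *)
exists (\sum_v tensor (h v) ((st v).1 + (st v).2 * tau0)).
exists (fun j => \sum_v tensor (h v) ((st v).2 * tau j) + tensor w' (peak_factor j)).
have w'_sos : sum_of_squares w'.
  rewrite /w' -mul_polyC; apply: sosM => //.
  by apply: (sos_rmorph _ (@polyC R)); apply: sos_ge0; rewrite mulr_ge0 // ltW.
have w'_size : (size w' <= m.+1)%N by exact: leq_trans (size_scale_leq _ _) wm.
have t_deg v : (msize (st v).2 <= (2 * (n * N)).+1)%N.
  have [_ _ _ _ td] := stP v; apply: leq_trans td _.
  exact: leq_trans (leq_subr _ _) (leqnSn _).
have sigma_g j :
    (\sum_v tensor (h v) ((st v).2 * tau j) + tensor w' (peak_factor j)) * (g j)%:P =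
    \sum_v tensor (h v) ((st v).2 * tau j * g j) + tensor w' (peak_factor j * g j).
  rewrite mulrDl mulr_suml (tensorM w' (peak_factor j) (g j)).
  by rewrite (eq_bigr _ (fun v _ => tensorM (h v) ((st v).2 * tau j) (g j))).
split.
- apply: sos_sum => v _; have [s_sos t_sos _ _ _] := stP v.
  by apply: sos_tensor => //; apply: sosD => //; exact: sosM.
- move=> j; apply: sosD.
    apply: sos_sum => v _; have [s_sos t_sos _ _ _] := stP v.
    by apply: sos_tensor => //; exact: sosM.
  by apply: sos_tensor => //; rewrite /peak_factor mulnC exprM; exact: sos_sqr.
- have -> : f = H + tensor w' (peak g c k) by rewrite subrK.
  have HB : H = \sum_v tensor (h v) ((st v).1 + (st v).2 * tau0) +
      \sum_j \sum_v tensor (h v) ((st v).2 * tau j * g j).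
    rewrite {1}(bernstein_expansionY N r D H r0 H_deg DN) exchange_big -big_split.
    apply: eq_bigr => v _ /=; rewrite -tensor_sumr -tensorD.
    have [_ _ -> _ _] := stP v; rewrite ballE mulrDr addrA mulr_sumr.
    by rewrite (eq_bigr _ (fun j _ => mulrA (st v).2 (tau j) (g j))).
  have peakE : tensor w' (peak g c k) = \sum_j tensor w' (peak_factor j * g j).
    by rewrite /peak tensor_sumr.
  by rewrite HB peakE (eq_bigr _ (fun j _ => sigma_g j)) big_split /= addrA.
- apply: leq_trans (tdeg_sum_tensor _ _ _ m (2 * (n * N) + a) h_size _) _.
    move=> v; have [_ _ _ sd _] := stP v; apply: msizeD_leq.
      by rewrite (leq_trans sd) // ltnS leq_addr.
    exact: msizeM_leq.
  by rewrite leq_add2l (leq_trans _ (leq_addr _ _)) // leq_add2r leq_addr.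
move=> j; rewrite sigma_g; apply: tdegD_leq.
  apply: tdeg_sum_tensor => // v.
  apply: leq_trans (msizeM_leq _ _ _ _ (msizeM_leq _ _ _ _ (t_deg v) (tau_deg j)) (g_deg j)) _.
  by rewrite ltnS leq_add2r leq_add2r leq_addr.
apply: tdeg_tensor => //.
have pf : (msize (peak_factor j) <= (2 * k * dg).+1)%N.
  apply: msizeXn_leq; apply: msizeD_leq; first by rewrite msize1.
  by rewrite msizeN (leq_trans (msizeZ_le _ _)).
apply: leq_trans (msizeM_leq _ _ _ _ pf (g_deg j)) _.
rewrite ltnS addnC -mulSn (leq_trans kD) // (leq_trans DN) //.
apply: leq_trans (leq_addl (2 * (n * N)) N) _.
exact: leq_trans (leq_addr a _) (leq_addr dg _).
Qed.

End Certificate.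

(** * Choice of the parameters *)

Section ParameterChoice.
Context {R : realType}.

(** Constants depending only on the [g j] are absorbed into exponents of a quantity that is at least
    3. *)
Lemma le_expr3 (C : R) : exists j : nat, forall Q, 3 <= Q -> C <= Q ^+ j.
Proof.
exists (Num.bound C) => Q Q3.
have [C0|C0] := leP C 0.
  by rewrite (le_trans C0) // exprn_ge0 //; lra.
have := archi_boundP (ltW C0); set j := Num.bound C => Cj.
apply: (le_trans (ltW Cj)); apply: (@le_trans _ _ (3 ^+ j)).
  by rewrite -natrX ler_nat ltnW // ltn_expl.
by rewrite lerXn2r ?nnegrE //; lra.
Qed.

Lemma le_expR (x : R) : x <= expR x.
Proof. by apply: le_trans (expR_ge1Dx x); lra. Qed.

Lemma exprn_le_expR (x : R) k : 0 <= x -> x ^+ k <= expR (x * k%:R).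
Proof.
by move=> x0; rewrite mulrC expRM_natl lerXn2r ?nnegrE ?expR_ge0 // le_expR.
Qed.

(** [L], [lambda], [k] and [D] stay below powers of Q; only [N], which must dominate G^(2k+1) and
    (3r)^D, becomes exponential. *)
Lemma parameter_choice (s p p0 dg : nat) (c G r : R) : 1 <= c -> 1 <= G -> 1 <= r ->
  exists A : nat, forall (Q kappa : R) (d : nat),
    3 <= Q -> 0 <= kappa <= Q -> d%:R <= Q -> r ^+ d <= Q ^+ p0 ->
    exists (L lambda : R) (k D N : nat),
    [/\ [/\ 1 <= L, kappa * (d%:R * r ^+ d) <= L,
            (kappa * r ^+ d + 1) * (2 * L) ^+ p <= lambda,
            2 * lambda * s%:R * c <= k%:R & (0 < k)%N],
        [/\ (d <= D)%N, ((2 * k).+1 * dg <= D)%N, (D <= N)%N & (0 < N)%N],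
        (kappa + lambda * (s%:R * G ^+ (2 * k).+1)) *
          (D%:R ^+ 2 * (3 * r) ^+ D) * 4 <= N%:R
      & N%:R <= expR (Q ^+ A)].
Proof.
move=> c1 G1 r1.
have [C1 C1P] := le_expr3 (2 * s%:R * c + 1).
have [C2 C2P] := le_expr3 (1 + 3 * dg%:R).
have [C3 C3P] := le_expr3 (1 + s%:R + 3 * G + (2 + 3 * r) + 6).
(* [a1], [a2], [a3] are the exponents for [lambda], [k], [D], and [a4] exceeds them all. In [a1],
   [p0.+2] pays for [kappa * r ^+ d + 1] and [p0.+3 * p] for [(2 * L) ^+ p]. *)
pose a1 := (p0.+2 + p0.+3 * p)%N; pose a2 := (C1 + a1)%N; pose a3 := (C2 + a2.+1)%N.
pose a4 := (a1 + a2 + a3).+1.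
have a14 : (a1 <= a4)%N by rewrite leqW // -addnA leq_addr.
have a24 : (a2 <= a4)%N by rewrite leqW // addnAC leq_addl.
have a34 : (a3 <= a4)%N by rewrite leqW // leq_addl.
exists (C3 + a4)%N => Q kappa d Q3 /andP[k0 kQ] dQ rQ.
have Q1 : 1 <= Q by lra.
have Q0 : 0 <= Q by lra.
have leX i j : (i <= j)%N -> Q ^+ i <= Q ^+ j by move=> ij; rewrite ler_weXn2l.
have X1 i : 1 <= Q ^+ i by rewrite exprn_ege1.
have X0 i : 0 <= Q ^+ i by rewrite exprn_ge0.
have rd0 : 0 <= r ^+ d by rewrite exprn_ge0 //; lra.
have s0 : 0 <= s%:R :> R by [].
have c0 : 0 <= c by lra.
pose L := Q ^+ p0.+2; pose lambda := Q ^+ a1.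
pose k := (Num.truncn (2 * lambda * s%:R * c)).+1.
pose D := (d + (2 * k).+1 * dg)%N.
pose X := (kappa + lambda * (s%:R * G ^+ (2 * k).+1)) * (D%:R ^+ 2 * (3 * r) ^+ D) * 4.
pose N := ((Num.truncn X).+1 + D)%N.
have lam0 : 0 <= lambda by exact: X0.
have l0 : 0 <= 2 * lambda * s%:R * c.
  by do 3?[apply: mulr_ge0].
have kl : 2 * lambda * s%:R * c <= k%:R by rewrite ltW // truncnS_gt.
have k_le : k%:R <= Q ^+ a2.
  rewrite -natr1 exprD; apply: (@le_trans _ _ ((2 * s%:R * c + 1) * lambda)).
    have : (Num.truncn (2 * lambda * s%:R * c))%:R <= 2 * lambda * s%:R * c.
      by rewrite truncn_le.
    have := X1 a1; rewrite -/lambda; lra.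
  by rewrite ler_wpM2r ?C1P // X0.
have k1 : 1 <= k%:R :> R by rewrite ler1n.
have M_le : ((2 * k).+1)%:R <= 3 * Q ^+ a2.
  by rewrite -natr1 natrM; move: k_le k1; lra.
have D_le : D%:R <= Q ^+ a3.
  rewrite natrD natrM exprD; apply: (@le_trans _ _ ((1 + 3 * dg%:R) * Q ^+ a2.+1)).
    rewrite [leRHS]mulrDl mul1r lerD //.
      by rewrite (le_trans dQ) // -[leLHS]expr1 leX.
    rewrite mulrAC ler_wpM2r // (le_trans M_le) // ler_wpM2l //; exact: leX.
  by rewrite ler_wpM2r ?C2P.
have M0 : 0 <= G ^+ (2 * k).+1 by rewrite exprn_ge0 //; lra.
have D20 : 0 <= D%:R ^+ 2 * (3 * r) ^+ D.
  by rewrite mulr_ge0 ?exprn_ge0 //; lra.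
have sG0 : 0 <= s%:R * G ^+ (2 * k).+1 by exact: mulr_ge0.
have lsG0 : 0 <= kappa + lambda * (s%:R * G ^+ (2 * k).+1).
  by rewrite addr_ge0 //; exact: mulr_ge0.
have X_ge0 : 0 <= X by do 2?[apply: mulr_ge0].
have D0 : 0 <= D%:R :> R by [].
have rD0 : 0 <= r * D%:R by rewrite mulr_ge0 //; lra.
have ls0 : 0 <= lambda * s%:R by exact: mulr_ge0.
have GM0 : 0 <= G * ((2 * k).+1)%:R by rewrite mulr_ge0 //; lra.
have XN : X <= N%:R.
  by rewrite natrD (le_trans (ltW (truncnS_gt _))) // lerDl.
have N_le : N%:R <= X + 1 + D%:R.
  by rewrite natrD -natr1 !lerD2r truncn_le.
(* [T1] bounds the logarithm of [X]: as b <= exp b, a power b^k contributes bk. The two [D%:R] come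
   from D^2, the final 4 from the factor 4. *)
pose T1 := kappa + lambda * s%:R + G * ((2 * k).+1)%:R + (D%:R + D%:R + 3 * r * D%:R) + 4.
have X_le : X <= expR T1.
  have h1 : kappa + lambda * (s%:R * G ^+ (2 * k).+1) <=
      expR (kappa + lambda * s%:R) * expR (G * ((2 * k).+1)%:R).
    apply: (@le_trans _ _ ((kappa + lambda * s%:R) * G ^+ (2 * k).+1)).
      rewrite mulrDl mulrA lerD2r ler_peMr // exprn_ege1 //.
    apply: ler_pM => //; [exact: addr_ge0 | exact: le_expR | ].
    by apply: exprn_le_expR; lra.
  have h2 : D%:R ^+ 2 * (3 * r) ^+ D <= expR (D%:R + D%:R) * expR (3 * r * D%:R).
    rewrite expRD -expr2; apply: ler_pM; [exact: exprn_ge0 | | | ].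
    - by rewrite exprn_ge0 //; lra.
    - by rewrite lerXn2r ?nnegrE ?expR_ge0 // le_expR.
    - by apply: exprn_le_expR; lra.
  rewrite /X /T1 expRD [expR (_ + (_ + _ + _))]expRD [expR (_ + _ + G * _)]expRD.
  rewrite [expR (_ + _ + 3 * r * _)]expRD.
  apply: ler_pM => //; [exact: mulr_ge0 | | exact: le_expR].
  exact: ler_pM.
have T1_le : T1 + 2 <= Q ^+ (C3 + a4).
  rewrite exprD.
  apply: (@le_trans _ _ ((1 + s%:R + 3 * G + (2 + 3 * r) + 6) * Q ^+ a4)); last first.
    by rewrite ler_wpM2r ?C3P.
  have h1 : kappa <= Q ^+ a4 by rewrite (le_trans kQ) // -[leLHS]expr1 leX.
  have h2 : lambda * s%:R <= s%:R * Q ^+ a4.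
    by rewrite mulrC ler_wpM2l // leX.
  have h3 : G * ((2 * k).+1)%:R <= 3 * G * Q ^+ a4.
    rewrite [3 * G]mulrC -mulrA ler_wpM2l //; first by lra.
    by rewrite (le_trans M_le) // ler_wpM2l // leX.
  have h4 : D%:R <= Q ^+ a4 by rewrite (le_trans D_le) // leX.
  have h5 : r * D%:R <= r * Q ^+ a4 by rewrite ler_wpM2l //; lra.
  have h6 := X1 a4.
  rewrite /T1; lra.
exists L, lambda, k, D, N; split=> //.
- have krQ : kappa * r ^+ d <= Q * Q ^+ p0 by exact: ler_pM.
  split=> //; first exact: X1.
    rewrite /L !exprS; apply: ler_pM => //; first exact: mulr_ge0.
    exact: ler_pM.
  rewrite /lambda exprD exprM; apply: ler_pM.
  + by rewrite addr_ge0 // mulr_ge0.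
  + by rewrite exprn_ge0 // mulr_ge0 // X0.
  + rewrite !exprS; have h1 : 1 <= Q * Q ^+ p0 by rewrite -exprS.
    apply: (@le_trans _ _ (3 * (Q * Q ^+ p0))); first by move: krQ; lra.
    by rewrite ler_wpM2r // mulr_ge0.
  + have L0 : 0 <= L by exact: X0.
    rewrite lerXn2r ?nnegrE ?X0 //; first exact: mulr_ge0.
    by rewrite [leRHS]exprS -/L ler_wpM2r //; lra.
- split; [exact: leq_addr | exact: leq_addl | exact: leq_addl | by []].
apply: (le_trans N_le).
(* Both X and 1 + D are at most exp T1, and twice exp T1 is below exp(T1 + 2). *)
apply: (@le_trans _ _ (expR (T1 + 2))); last by rewrite ler_expR.
rewrite expRD; have e2 : 1 + 2 <= expR 2 :> R by exact: expR_ge1Dx.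
have eT : 1 + D%:R <= expR T1.
  apply: le_trans (expR_ge1Dx _) _; rewrite ler_expR /T1; lra.
have := expR_gt0 T1; move: X_le eT e2; nra.
Qed.

End ParameterChoice.

(** * The norm and the homogenization *)

Section Multinomial.
Context {R : realType} {n : nat}.
Implicit Types (m : 'X_{1..n}).

Lemma mcoeffMXU (p : {mpoly R[n]}) i m :
  (p * 'X_i)@_m = if (0 < m i)%N then p@_(m - U_(i)) else 0.
Proof.
case: ifPn => mi; last first.
  apply/eqP; rewrite mcoeff_eq0; apply/negP; rewrite (perm_mem (msuppMX _ _)).
  by move=> /mapP[m' _ mE]; move: mi; rewrite mE mnmDE mnm1E eqxx.
rewrite -[m in LHS](@submK _ U_(i) m); last first.
  by apply/mnm_lepP => j; rewrite mnm1E; case: eqP => // <-.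
by rewrite addmC mcoeffMX.
Qed.

Lemma multinomial_ge0 m : 0 <= multinomial m :> R.
Proof. by rewrite divr_ge0 // prodr_ge0. Qed.

Lemma multinomial_gt0 m : 0 < multinomial m :> R.
Proof. by rewrite divr_gt0 ?ltr0n ?fact_gt0 // prodr_gt0 // => i _; rewrite ltr0n fact_gt0. Qed.

Lemma multinomial_sub1 i m : (0 < m i)%N ->
  multinomial (m - U_(i)) = multinomial m * (m i)%:R / (mdeg m)%:R :> R.
Proof.
move=> mi; have leU : (U_(i) <= m)%MM.
  by apply/mnm_lepP => j; rewrite mnm1E; case: eqP => // <-.
have degE : mdeg m = (mdeg (m - U_(i))).+1.
  by rewrite -[m in LHS](submK leU) mdegD mdeg1 addn1.
rewrite /multinomial degE factS natrM.
rewrite [X in _ / X = _](bigD1 i) //= [X in _ = _ / X * _ / _](bigD1 i) //=.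
have -> : \prod_(j < n | j != i) ((m - U_(i))%MM j)`!%:R =
          \prod_(j < n | j != i) (m j)`!%:R :> R.
  by apply: eq_bigr => j ji; rewrite mnmBE mnm1E eq_sym (negPf ji) subn0.
rewrite mnmBE mnm1E eqxx subn1; set P := \prod_(_ < _ | _) _.
have P0 : P != 0 by rewrite gt_eqF // prodr_gt0 // => j _; rewrite ltr0n fact_gt0.
have -> : (m i)`!%:R = (m i)%:R * ((m i).-1)`!%:R :> R.
  by rewrite -natrM -[in RHS](prednK mi) -factS prednK.
have f0 k : k`!%:R != 0 :> R by rewrite pnatr_eq0 -lt0n fact_gt0.
by field; rewrite f0 P0 addrC natr1 !pnatr_eq0 -!lt0n mi.
Qed.

(** The multinomial theorem. In the inductive step the coefficients at [m - U_(i)] are the fractions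
    (m i)/|m| of [multinomial m], and these add up to 1. *)
Lemma mcoeff_sum_vars k m :
  ((\sum_(i < n) 'X_i) ^+ k : {mpoly R[n]})@_m = (mdeg m == k)%:R * multinomial m.
Proof.
elim: k m => [|k IHk] m.
  rewrite expr0 mcoeff1 mdeg_eq0; case: eqP => [->|_]; last by rewrite mul0r.
  rewrite mul1r /multinomial mdeg0 big1 ?divr1 // => i _.
  by rewrite mnm0E.
rewrite exprSr mulr_sumr raddf_sum /=.
under eq_bigr => i _ do rewrite mcoeffMXU.
case: (eqVneq (mdeg m) k.+1) => [mk|mk]; last first.
  rewrite mul0r big1 // => i _; case: ifPn => // mi; rewrite IHk.
  case: eqP => [degk|]; last by rewrite mul0r.
  have leU : (U_(i) <= m)%MM.
    by apply/mnm_lepP => j; rewrite mnm1E; case: eqP => // <-.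
  by move: mk; rewrite -(submK leU) mdegD mdeg1 degk addn1 eqxx.
transitivity (\sum_(i < n) multinomial m * (m i)%:R / (mdeg m)%:R : R).
  apply: eq_bigr => i _; case: posnP => [->|mi]; first by rewrite mulr0 mul0r.
  rewrite IHk multinomial_sub1 // (_ : mdeg _ == k) ?mul1r //.
  have leU : (U_(i) <= m)%MM.
    by apply/mnm_lepP => j; rewrite mnm1E; case: eqP => // <-.
  by rewrite -eqSS -mk -{2}(submK leU) mdegD mdeg1 addn1.
rewrite -mulr_suml -mulr_sumr -natr_sum -mdegE mul1r mulfK // mk.
by rewrite pnatr_eq0.
Qed.

(** Evaluating the k-th power of X_1 + ... + X_n at the all-ones point shows that the multinomials
    of degree k add up to n^k, at most n^d because n >= 1. *)
Lemma sum_multinomial_le d : (0 < n)%N ->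
  \sum_(m : 'X_{1..n < d.+1}) multinomial m <= d.+1%:R * n%:R ^+ d :> R.
Proof.
move=> n0; pose S : {mpoly R[n]} := \sum_(i < n) 'X_i.
have Sdeg k : (k <= d)%N -> (msize (S ^+ k) <= d.+1)%N.
  move=> kd; apply: (@leq_trans (k * 1).+1); last by rewrite muln1.
  by apply: msizeXn_leq; apply: msize_sum_leq => i _; exact: msizeX_leq.
have Seval k : (k <= d)%N ->
    \sum_(m : 'X_{1..n < d.+1}) (mdeg m == k)%:R * multinomial m = n%:R ^+ k :> R.
  move=> kd; have : (S ^+ k).@[fun=> 1] = n%:R ^+ k.
    rewrite rmorphXn /= raddf_sum /=; congr (_ ^+ _).
    under eq_bigr => i _ do rewrite mevalXU.
    by rewrite sumr_const card_ord.
  rewrite mevalE => <-.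
  rewrite (sum_msupp_wide _ _ (fun m => \prod_i 1 ^+ m i) (Sdeg k kd)).
  apply: eq_bigr => m _; rewrite mcoeff_sum_vars.
  by rewrite [X in _ = _ * X]big1 ?mulr1 // => i _; rewrite expr1n.
apply: (@le_trans _ _ (\sum_(k < d.+1) n%:R ^+ k)).
  rewrite -(eq_bigr _ (fun (k : 'I_d.+1) _ => Seval k (ltn_ord k))) exchange_big.
  apply: ler_sum => m _; rewrite -mulr_suml ler_peMl ?multinomial_ge0 //.
  rewrite (bigD1 (Ordinal (bmdeg m))) //= eqxx lerDl.
  exact: sumr_ge0.
rewrite -[d.+1 in leRHS]card_ord mulr_natl -sumr_const.
apply: ler_sum => k _; rewrite ler_weXn2l ?ler1n //.
by rewrite -ltnS.
Qed.

End Multinomial.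

Section Homogenization.
Context {R : realType} {n : nat}.
Implicit Types (f : {poly {mpoly R[n]}}) (x : 'I_n -> R) (y z : R).

Lemma evalXYE x y f :
  evalXY x y f = \sum_(i < (degY f).+1) (f`_i).@[x] * y ^+ i.
Proof.
have szf : (size (specX x f) <= (degY f).+1)%N.
  by rewrite (leq_trans (size_poly _ _)) // /degY leqSpred.
rewrite /evalXY (horner_coef_wide _ szf); apply: eq_bigr => i _.
by rewrite /specX coef_map.
Qed.

Lemma evalXYZ_homogY x y z f : evalXYZ x y z (homogY f) =
  \sum_(i < (degY f).+1) (f`_i).@[x] * y ^+ i * z ^+ (degY f - i).
Proof.
rewrite /evalXYZ (_ : map_poly (evalXY x y) (homogY f) =
  map_poly (horner_eval y \o map_poly (meval x)) (homogY f)); last exact: eq_map_poly.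
rewrite /homogY rmorph_sum /= horner_sum; apply: eq_bigr => i _.
rewrite rmorphM /= map_polyC map_polyXn /= hornerM hornerC hornerXn; congr (_ * _).
by rewrite /horner_eval rmorphM /= map_polyC map_polyXn /= hornerM hornerC hornerXn.
Qed.

(** For even [m], the m-th power of the length of (y, 1). For odd [m] the half rounds down;
    [degY_even] excludes this case. *)
Definition circle_weight (m : nat) : {poly R} := (1 + 'X ^+ 2) ^+ m./2.

Lemma horner_circle_weight m y : (circle_weight m).[y] = (1 + y ^+ 2) ^+ m./2.
Proof. by rewrite /circle_weight horner_exp !hornerE. Qed.

Lemma circle_weight_gt0 m y : 0 < (circle_weight m).[y].
Proof. by rewrite horner_circle_weight exprn_gt0 // ltr_pwDl // sqr_ge0. Qed.

Lemma circle_weight_sos m : sum_of_squares (circle_weight m).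
Proof. by apply: sosX; apply: sosD; [exact: sos1 | exact: sos_sqr]. Qed.

Lemma size_circle_weight m : (size (circle_weight m) <= m.+1)%N.
Proof.
apply: leq_trans (size_exp_leq _ _) _; rewrite ltnS.
have sz : (size ((1 + 'X ^+ 2)%R : {poly R}) <= 3)%N.
  by rewrite (leq_trans (size_polyD _ _)) // size_poly1 size_polyXn.
have : ((size ((1 + 'X ^+ 2)%R : {poly R})).-1 * m./2 <= 2 * m./2)%N.
  by rewrite leq_mul2r; apply/orP; right; case: (size _) sz.
move=> /leq_trans; apply; rewrite mul2n -[leqRHS](odd_double_half m).
exact: leq_addl.
Qed.

Lemma abs_pow_le_circle_weight m y i : ~~ odd m -> (i <= m)%N ->
  `|y| ^+ i <= (circle_weight m).[y].
Proof.
move=> m_even im; rewrite horner_circle_weight.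
have b1 : 1 <= 1 + y ^+ 2 by rewrite lerDl sqr_ge0.
rewrite -ler_sqr ?nnegrE ?exprn_ge0 //; last by lra.
rewrite -!exprM mulnC exprM real_normK ?num_real // muln2 halfK (negPf m_even) subn0.
apply: (@le_trans _ _ ((1 + y ^+ 2) ^+ i)).
  by rewrite lerXn2r ?nnegrE ?sqr_ge0 //; have := sqr_ge0 y; lra.
by rewrite ler_weXn2l.
Qed.

Section Minimum.
Variables (S : set ('I_n -> R)) (f : {poly {mpoly R[n]}}) (fmin : R).
Hypothesis S_neq0 : S !=set0.
Hypothesis f_min : is_min (circle_values S f) fmin.
Hypothesis fmin_gt0 : 0 < fmin.

Let min_le x y z : S x -> y ^+ 2 + z ^+ 2 = 1 ->
  fmin <= \sum_(i < (degY f).+1) (f`_i).@[x] * y ^+ i * z ^+ (degY f - i).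
Proof.
move=> Sx yz; rewrite -evalXYZ_homogY; have [_] := f_min; apply.
by exists (x, (y, z)).
Qed.

(** At (1, 0) and (-1, 0) the homogenization takes the values f_m(x) and (-1)^m f_m(x), and both
    must be positive. *)
Lemma degY_even : ~~ odd (degY f).
Proof.
apply/negP => m_odd; have [x Sx] := S_neq0.
have h1 := min_le x 1 0 Sx; have h2 := min_le x (- 1) 0 Sx.
have h : \sum_(i < (degY f).+1) (f`_i).@[x] * (- 1) ^+ i * 0 ^+ (degY f - i) =
  - \sum_(i < (degY f).+1) (f`_i).@[x] * 1 ^+ i * 0 ^+ (degY f - i) :> R.
  (* Powers of z = 0 vanish except for i = m, where 0^0 = 1. *)
  rewrite -sumrN; apply: eq_bigr => i _; rewrite expr0n expr1n subn_eq0.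
  case: (leqP (degY f) i) => [mi|_]; last by rewrite !mulr0 oppr0.
  have -> : (i : nat) = degY f.
    by apply/eqP; rewrite eqn_leq mi -ltnS ltn_ord.
  by rewrite -signr_odd m_odd expr1 mulr1 mulrN1 !mulr1.
have e1 : 1 ^+ 2 + 0 ^+ 2 = 1 :> R by ring.
have e2 : (- 1) ^+ 2 + 0 ^+ 2 = 1 :> R by ring.
by have := h1 e1; have := h2 e2; rewrite h; move: fmin_gt0; lra.
Qed.

(** The point (y, 1) is scaled to (y/w, 1/w) on the circle; homogeneity of degree m brings in the
    factor w^m. *)
Lemma circle_weight_le x y : S x -> fmin * (circle_weight (degY f)).[y] <= evalXY x y f.
Proof.
move=> Sx; pose w := Num.sqrt (1 + y ^+ 2).
have b0 : 0 < 1 + y ^+ 2 by rewrite ltr_pwDl // sqr_ge0.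
have w0 : 0 < w by rewrite sqrtr_gt0.
have w2 : w ^+ 2 = 1 + y ^+ 2 by rewrite sqr_sqrtr // ltW.
have wm : (circle_weight (degY f)).[y] = w ^+ degY f.
  rewrite horner_circle_weight -w2 -exprM mul2n halfK (negPf degY_even) subn0 //.
rewrite wm -ler_pdivlMr ?exprn_gt0 //.
apply: le_trans (min_le x (y / w) w^-1 Sx _) _.
  rewrite expr_div_n exprVn w2; field; rewrite gt_eqF //.
rewrite evalXYE mulr_suml le_eqVlt; apply/orP; left; apply/eqP; apply: eq_bigr => i _.
have im : (i <= degY f)%N by rewrite -ltnS.
rewrite expr_div_n exprVn -!mulrA; congr (_ * (_ * _)).
by rewrite -invfM -exprD subnKC.
Qed.

End Minimum.

Lemma bullet_norm_ge f i (m : 'X_{1..n < (degX f).+1}) : (i < (degY f).+1)%N ->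
  `|(f`_i)@_m| <= bullet_norm f * multinomial m.
Proof.
move=> im; rewrite -ler_pdivrMr ?multinomial_gt0 //.
rewrite -[X in _ / X]gtr0_norm ?multinomial_gt0 // -normf_div.
rewrite /bullet_norm; apply: le_trans (le_bigmax _ _ (Ordinal im)) => /=.
exact: (le_bigmax _ (fun m : 'X_{1..n < (degX f).+1} => `|(f`_i)@_m / multinomial m|) m).
Qed.

Lemma bullet_norm_ge0 f : 0 <= bullet_norm f.
Proof.
by rewrite /bullet_norm; elim/big_ind: _ => // [u v u0 v0|i _];
  [rewrite le_max u0 | elim/big_ind: _ => // u v u0 v0; rewrite le_max u0].
Qed.

Lemma msize_coef_leq f i : (msize f`_i <= (degX f).+1)%N.
Proof.
case: (ltnP i (size f)) => [i_lt|i_ge]; last by rewrite nth_default // msize0.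
have := leq_bigmax (Ordinal i_lt) : (_ <= degX f)%N => /=.
by case: (msize _).
Qed.

(** Each coefficient of f(., y) is a sum of m + 1 terms, each at most the norm times a multinomial
    times the weight; the multinomials are then summed by [sum_multinomial_le]. *)
Lemma l1norm_horner_le f y : (0 < n)%N -> ~~ odd (degY f) ->
  l1norm f.[y%:MP] <= bullet_norm f * (degY f).+1%:R *
    ((degX f).+1%:R * n%:R ^+ degX f) * (circle_weight (degY f)).[y].
Proof.
move=> n0 m_even; have w0 := circle_weight_gt0 (degY f) y.
set w := (circle_weight _).[y] in w0 *.
rewrite (l1normwE _ _ (msize_horner_leq _ _ _ (msize_coef_leq f))).
apply: (@le_trans _ _ (\sum_(m : 'X_{1..n < (degX f).+1})
    bullet_norm f * (degY f).+1%:R * w * multinomial m)).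
  apply: ler_sum => m _; rewrite (mcoeff_horner _ (degY f).+1); last exact: leqSpred.
  rewrite (le_trans (ler_norm_sum _ _ _)) //.
  apply: (@le_trans _ _ (\sum_(i < (degY f).+1) bullet_norm f * multinomial m * w)).
    apply: ler_sum => i _; rewrite normrM normrX.
    apply: ler_pM => //; [exact: exprn_ge0 | exact: bullet_norm_ge | ].
    by apply: abs_pow_le_circle_weight => //; rewrite -ltnS.
  rewrite sumr_const card_ord -[leLHS]mulr_natl le_eqVlt; apply/orP; left; apply/eqP.
  by ring.
rewrite -mulr_sumr mulrAC ler_wpM2r ?(ltW w0) // ler_wpM2l ?sum_multinomial_le //.
by rewrite mulr_ge0 // bullet_norm_ge0.
Qed.

End Homogenization.

(** * The theorem *)

Section DegreeZero.
Context {R : realType} {n : nat}.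

(** The case d = 0 is separate because the quotient raised to the power c in the bound vanishes.
    Here f is a polynomial in Y alone, nonnegative by specialization at a point of S. *)
Lemma degX0_sos (S : set ('I_n -> R)) (f : {poly {mpoly R[n]}}) :
  S !=set0 -> (forall x y, S x -> 0 < evalXY x y f) -> degX f = 0%N ->
  sum_of_squares f /\ (tdeg f <= degY f)%N.
Proof.
move=> [x Sx] f_gt0 d0; have fd i : (msize f`_i <= 1)%N.
  by have := msize_coef_leq f i; rewrite d0.
split; last first.
  apply: tdeg_leq => i fi0; have i_lt : (i < size f)%N.
    by rewrite ltnNge; apply: contraNN fi0 => ?; rewrite nth_default.
  rewrite -[(degY f).+1]add1n leq_add // /degY.
  by case: (size f) i_lt.
pose p : {poly R} := map_poly (meval x) f.
have fE : f = map_poly (mpolyC n (R := R)) p.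
  apply/polyP => i; rewrite !coef_map /= [in RHS](msize1_polyC (fd i)) mevalC.
  exact: msize1_polyC.
rewrite fE; apply: (sos_rmorph _ (map_poly (mpolyC n (R := R)))).
by apply: nonneg_poly_sos => y; apply: ltW; exact: f_gt0.
Qed.

End DegreeZero.

Section Estimates.
Context {R : realType}.

(** From K >= 3/2 one gets K^2 >= 2, hence 2K <= K^3: tripling the exponent removes the factor 2. *)
Lemma double_expr_le (K : R) (A k : nat) : 3 <= 2 * K -> (3 * A <= k)%N ->
  (2 * K) ^+ A <= K ^+ k.
Proof.
move=> K3 Ak; have K1 : 1 <= K by lra.
apply: (@le_trans _ _ (K ^+ (3 * A))); last by rewrite ler_weXn2l.
rewrite exprM lerXn2r ?nnegrE ?exprn_ge0 //; try lra.
have KK : 2 <= K * K by nra.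
by rewrite exprSr expr2 ler_wpM2r //; lra.
Qed.

Lemma one_le_powR2 (x : R) : 0 <= x -> 1 <= 2 `^ x.
Proof.
move=> x0; have h : 1 <= 2 :> R by rewrite ler1n.
by have := ler_powR h x0; rewrite powRr0.
Qed.

Lemma degree_estimate (q m n N a dg c : nat) (E : R) :
  (q <= m + (2 * (n * N) + N + a + dg))%N -> N%:R <= E -> 1 <= E ->
  (2 * n + 2 + a + dg <= c)%N -> q%:R <= c%:R * m.+1%:R * E.
Proof.
rewrite -[m.+1%:R]natr1 -!(ler_nat R) !natrD !natrM => qm NE E1 c_ge.
have m0 : 0 <= m%:R :> R by []. have n0 : 0 <= n%:R :> R by [].
have a0 : 0 <= a%:R :> R by []. have g0 : 0 <= dg%:R :> R by [].
have h : (2 * n%:R + 2 + a%:R + dg%:R) * (m%:R + 1) * E <= c%:R * (m%:R + 1) * E.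
  by rewrite ler_wpM2r ?ler_wpM2r //; lra.
apply: le_trans h; apply: (le_trans qm).
have nN : n%:R * N%:R <= n%:R * E by rewrite ler_wpM2l.
have mE : m%:R <= m%:R * E by rewrite ler_peMr.
have aE : a%:R <= a%:R * E by rewrite ler_peMr.
have gE : dg%:R <= dg%:R * E by rewrite ler_peMr.
have E0 : 0 <= E by lra.
apply: (@le_trans _ _ ((2 * n%:R + 2 + a%:R + dg%:R) * E + m%:R * E)); first by lra.
rewrite -mulrDl ler_wpM2r // mulrDr mulr1 [leRHS]addrC lerD2l ler_peMl //.
lra.
Qed.

End Estimates.

Theorem theorem7 (R : realType) (n s : nat) (hn : (0 < n)%N) (hs : (0 < s)%N)
    (g : 'I_s -> {mpoly R[n]})
    (S_neq0 : nonneg_set g !=set0)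
    (S_cube : nonneg_set g `<=` [set x | forall i, -1 < x i < 1])
    (g_arch : archimedean g) :
  exists2 c : R, 0 < c &
    forall (f : {poly {mpoly R[n]}}) (d m : nat) (fmin : R),
      (forall x y, nonneg_set g x -> 0 < evalXY x y f) ->
      degX f = d ->
      degY f = m ->
      fully_ic m (nonneg_set g) f ->
      is_min (circle_values (nonneg_set g) f) fmin ->
      0 < fmin ->
      let bound : R :=
        c * m.+1%:R * 2 `^ (m%:R / 2) *
        expR ((bullet_norm f * m.+1%:R * d%:R ^+ 2 * (3 * n)%:R ^+ d / fmin)
                `^ c) in
      exists (sigma0 : {poly {mpoly R[n]}}) (sigma : 'I_s -> {poly {mpoly R[n]}}),
        [/\ sum_of_squares sigma0,
            (forall i, sum_of_squares (sigma i)),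
            f = sigma0 + \sum_(i < s) sigma i * (g i)%:P,
            (tdeg sigma0)%:R <= bound
          & forall i, (tdeg (sigma i * (g i)%:P))%:R <= bound].
Proof.
have [N0 N0_gt0 [tau0' [tau [tau0'_sos tau_sos archE]]]] := g_arch.
(* A radius with r^2 >= N0 puts r^2 - sum X_i^2 in the module, the constant r^2 - N0 being a square
   added to the free term. *)
have [r r1 rN0] : exists2 r, 1 <= r & 0 <= r ^+ 2 - N0.
  by exists (1 + N0); [lra | nra].
pose tau0 := tau0' + (r ^+ 2 - N0)%:MP.
have tau0_sos : sum_of_squares tau0 by apply: sosD => //; exact: sos_mpolyC.
have ballE : ball_poly r = tau0 + \sum_j tau j * g j.
  rewrite /tau0 addrAC -archE /ball_poly mpolyCB; ring.
have [dg g_deg] : exists dg, forall j, (msize (g j) <= dg.+1)%N.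
  by exists (\max_j msize (g j))%N => j; rewrite leqW // (leq_bigmax j).
have [a tau0_deg tau_deg] : exists2 a, (msize tau0 <= a.+1)%N &
    forall j, (msize (tau j) <= a.+1)%N.
  exists (maxn (msize tau0) (\max_j msize (tau j))).
    by rewrite leqW // leq_maxl.
  by move=> j; rewrite leqW // (leq_trans _ (leq_maxr _ _)) // (leq_bigmax j).
have [G G1 g_l1] : exists2 G, 1 <= G & forall j, l1norm (g j) + 1 <= G.
  have l1_ge0 j : 0 <= l1norm (g j) by exact: l1norm_ge0.
  exists (\sum_j l1norm (g j) + 1); first by rewrite lerDr sumr_ge0.
  by move=> j; rewrite lerD2r (bigD1 j) //= lerDl sumr_ge0.
have [cb cb1 g_bound] : exists2 cb, 1 <= cb &
    forall x j, (forall i, - r <= x i <= r) -> `|(g j).@[x]| <= cb.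
  have rdg : 1 <= r ^+ dg by rewrite exprn_ege1.
  exists (G * r ^+ dg); first by rewrite (le_trans G1) // ler_peMr // (le_trans _ G1).
  move=> x j xr; apply: (le_trans (meval_bound r r1 (g j) x dg (g_deg j) _)).
    by move=> i; rewrite ler_norml.
  rewrite ler_wpM2r //; first exact: le_trans rdg.
  by apply: le_trans (g_l1 j); rewrite lerDl.
have [p loj] := lojasiewicz g r.
have [p0 p0P] := le_expr3 r.
have [A params] := parameter_choice s p p0 dg cb G r cb1 G1 r1.
(* One constant serves twice: 3A as the exponent required by [double_expr_le], the rest as the
   linear factor in [degree_estimate]. *)
pose c0 := (3 * A + (2 * n + 2 + a + dg))%N.
exists c0%:R; first by rewrite ltr0n /c0; lia.
move=> f d m fmin f_gt0 fd fm _ f_min fmin_gt0 bound.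
have mE : (2 `^ (m%:R / 2) : R) >= 1 by apply: one_le_powR2; rewrite divr_ge0.
have c0_ge1 : 1 <= c0%:R :> R by rewrite ler1n /c0; lia.
have m1 : 1 <= m.+1%:R :> R by rewrite ler1n.
have boundE : c0%:R * m.+1%:R * expR ((bullet_norm f * m.+1%:R * d%:R ^+ 2 *
    (3 * n)%:R ^+ d / fmin) `^ c0%:R) <= bound.
  by rewrite /bound ler_wpM2r ?expR_ge0 // ler_peMr // mulr_ge0.
have [d0|d_gt0] := posnP d.
  have [f_sos f_tdeg] := degX0_sos _ f S_neq0 f_gt0 (etrans fd d0).
  have m_bound : m%:R <= bound.
    apply: le_trans boundE; apply: (@le_trans _ _ (c0%:R * m.+1%:R)).
      by rewrite (@le_trans _ _ m.+1%:R) ?ler_nat // ler_peMl.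
    rewrite ler_peMr // ?mulr_ge0 // -expR0 ler_expR powR_ge0 //.
  exists f, (fun=> 0); split=> //.
  - by move=> i; exact: sos0.
  - by rewrite big1 ?addr0 // => i _; rewrite mul0r.
  - by apply: le_trans m_bound; rewrite ler_nat -fm.
  - by move=> i; rewrite mul0r tdeg0; apply: le_trans m_bound.
set K := bullet_norm f * _ * _ * _ / _ in boundE.
pose kappa := bullet_norm f * m.+1%:R * (d.+1%:R * n%:R ^+ d) / fmin.
have w0 := @circle_weight_gt0 R m.
have m_even : ~~ odd m by rewrite -fm; exact: degY_even S_neq0 f_min fmin_gt0.
have f_l1 y : l1norm f.[y%:MP] <= kappa * (fmin * (circle_weight m).[y]).
  have := l1norm_horner_le f y hn; rewrite fd fm => /(_ m_even) /le_trans; apply.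
  by rewrite [leRHS]mulrA /kappa mulfVK // gt_eqF.
have f_low x y : nonneg_set g x -> fmin * (circle_weight m).[y] <= evalXY x y f.
  by rewrite -fm; exact: circle_weight_le S_neq0 f_min fmin_gt0 x y.
have f_deg i : (msize f`_i <= d.+1)%N by rewrite -fd msize_coef_leq.
(* At a point of S and y = 0, the lower bound [fmin * w] meets the upper bound [kappa * (fmin * w)];
   the latter holds there because S lies in the unit cube. *)
have kappa1 : 1 <= kappa.
  have [x Sx] := S_neq0.
  have muw : 0 < fmin * (circle_weight m).[0] by rewrite mulr_gt0.
  rewrite -(ler_pM2r muw) mul1r; apply: le_trans (f_l1 0).
  apply: le_trans (f_low x 0 Sx) _; rewrite -meval_horner.
  apply: le_trans (ler_norm _) _.
  have := meval_bound 1 (lexx 1) f.[0%:MP] x d; rewrite expr1n mulr1; apply.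
    exact: msize_horner_leq.
  by move=> i; have /andP[x1 x2] := S_cube x Sx i; rewrite ler_norml !ltW.
(* For d >= 1, d + 1 <= 2d^2 trades the factor d + 1 of [kappa] for the d^2 of [K]. The factor 3^d
   is kept: with [kappa >= 1] it makes 2K dominate 3, d and, up to the power [p0], r^d. *)
have kappaK : kappa * 3 ^+ d <= 2 * K.
  pose B := bullet_norm f * m.+1%:R * n%:R ^+ d * 3 ^+ d / fmin.
  have B0 : 0 <= B.
    apply: divr_ge0 (ltW fmin_gt0); apply: mulr_ge0; last exact: exprn_ge0.
    by apply: mulr_ge0; [apply: mulr_ge0 => //; exact: bullet_norm_ge0 | exact: exprn_ge0].
  have -> : kappa * 3 ^+ d = B * d.+1%:R by rewrite /kappa /B; ring.
  have -> : 2 * K = B * (2 * d%:R ^+ 2) by rewrite /K /B natrM exprMn; ring.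
  have d1 : 1 <= d%:R :> R by rewrite ler1n.
  by rewrite ler_wpM2l // -natr1; nra.
have d3 : 3 <= 3 ^+ d :> R by rewrite -[leLHS]expr1 ler_weXn2l // ler1n.
have k3 : 3 ^+ d <= kappa * 3 ^+ d by rewrite ler_peMl // exprn_ge0.
have Q3 : 3 <= 2 * K by lra.
have kQ : 0 <= kappa <= 2 * K.
  apply/andP; split; first by lra.
  by apply: le_trans kappaK; rewrite ler_peMr //; lra.
have dQ : d%:R <= 2 * K.
  apply: (@le_trans _ _ (3 ^+ d)); last by lra.
  by rewrite -natrX ler_nat ltnW // ltn_expl.
have rQ : r ^+ d <= (2 * K) ^+ p0.
  apply: (@le_trans _ _ ((3 ^+ p0) ^+ d)).
    by rewrite lerXn2r ?nnegrE ?exprn_ge0 ?p0P //; lra.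
  rewrite exprAC lerXn2r ?nnegrE ?exprn_ge0 //; lra.
have [L [lambda [k [D [N [[L1 Ld Ll lk k0] [dD kD DN NN0] HN N_le]]]]]] :=
  params (2 * K) kappa d Q3 kQ dQ rQ.
have [||sigma0 [sigma [s0_sos s_sos fE deg0 deg]]] := certificate g r cb p a dg G tau0 tau
  r1 cb1 S_cube g_bound loj g_deg g_l1 tau0_sos tau_sos ballE tau0_deg tau_deg
  f (circle_weight m) m d k D N fmin kappa L lambda f_deg _ _ fmin_gt0
  (circle_weight_sos m) w0 f_l1 f_low L1 Ld Ll lk k0 dD kD DN NN0 HN.
- by rewrite -fm leqSpred.
- exact: size_circle_weight.
have deg_bound q : (q <= m + (2 * (n * N) + N + a + dg))%N -> q%:R <= bound.
  move=> qle; apply: le_trans boundE; rewrite powR_mulrn; last by lra.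
  have : (2 * K) ^+ A <= K ^+ c0 by apply: double_expr_le => //; exact: leq_addr.
  rewrite -ler_expR => /(le_trans N_le) NE.
  apply: (degree_estimate _ _ _ _ _ _ _ _ qle NE).
    by rewrite -expR0 ler_expR exprn_ge0 //; lra.
  exact: leq_addl.
exists sigma0, sigma; split=> //; first exact: deg_bound.
by move=> i; apply: deg_bound; exact: deg.
Qed.
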